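(* For all $M>0$, $R>0$ and $d\in\mathbb{N}^*$ there exists $C>0$ such that the following holds. Let $\mu,\nu$ be probability measures on $\mathbb{R}^d$ compactly supported in $B_R$, such that $\mu$ has a density with respect to Lebesgue measure upper bounded by $M$. For $n,m\in\mathbb{N}^*$, let $X_1,\ldots,X_n$ and $Y_1,\ldots,Y_m$ be i.i.d. random samples with respective distributions $\mu$ and $\nu$, and let $\hat\mu_n=\frac1n\sum_{i=1}^n\delta_{X_i}$, $\hat\nu_m=\frac1m\sum_{j=1}^m\delta_{Y_j}$. Let $\bar\varphi$ be an optimal Brenier potential for $(\mu,\nu)$, and let $\hat T_{n,m}$ be the Monge map estimator (defined in the context) for the empirical measures $\hat\mu_n,\hat\nu_m$. Then $$\mathbb{E}\left[\int_{\mathbb{R}^d}\|\nabla\bar\varphi(x)-\hat T_{n,m}(x)\|\,d\mu(x)\right]\le C\begin{cases}\left(n^{-1/2}+m^{-1/2}\right)^{1/4}&\text{if } d=1,\\ \left(n^{-1/2}\log(1+n)+m^{-1/2}\log(1+m)\right)^{1/4}&\text{if } d=2,\\ \left(n^{-1/d}+m^{-1/d}\right)^{1/4}&\text{if } d>2.\end{cases}$$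
   Context: $B_R$ is the open Euclidean ball of $\mathbb{R}^d$ centered at $0$ with radius $R$. $\Gamma_0(\mathbb{R}^d)$ is the set of proper lower semicontinuous convex functions $\mathbb{R}^d\to\mathbb{R}\cup\{+\infty\}$; $\varphi^*(y)=\sup_{x}\langle x,y\rangle-\varphi(x)$; $\partial\varphi$ is the convex subdifferential. An optimal Brenier potential for a pair $(\mu,\nu)$ of compactly supported probability measures is a function $\varphi\in\Gamma_0(\mathbb{R}^d)$ attaining $\inf_{\varphi\in\Gamma_0(\mathbb{R}^d)}\int\varphi\,d\mu+\int\varphi^*\,d\nu$. Monge map estimator. For discrete measures $\hat\mu=\sum_{i=1}^n a_i\delta_{x_i}$, $\hat\nu=\sum_{j=1}^m b_j\delta_{y_j}$ with positive weights summing to one, let $(f,g)\in\mathbb{R}^n\times\mathbb{R}^m$ be an optimal solution of the dual discrete optimal transport problem $\max\{\langle f,a\rangle+\langle g,b\rangle \mid f\in\mathbb{R}^n, g\in\mathbb{R}^m, f_i+g_j\le\frac12\|x_i-y_j\|^2\ \forall i,j\}$, and set $\varphi_g(x)=\max_{k=1,\ldots,m}\langle x,y_k\rangle+g_k-\frac12\|y_k\|^2$. The estimator is any selection $\hat T:\mathbb{R}^d\to\mathbb{R}^d$ with $\hat T(x)\in\partial\varphi_g(x)$ for all $x\in\mathbb{R}^d$; for example $\hat T(x)=\frac{1}{|I(x)|}\sum_{j\in I(x)}y_j$ with $I(x)=\{j\mid\varphi_g(x)=\langle x,y_j\rangle+g_j-\frac12\|y_j\|^2\}$. Here it is applied with $x_i=X_i$,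 $a_i=1/n$, $y_j=Y_j$, $b_j=1/m$. *)

(* Defs.v *)
From HB Require Import structures.
From mathcomp Require Import all_boot all_order all_algebra.
From mathcomp Require Import all_classical all_reals all_analysis.

Set Implicit Arguments.
Unset Strict Implicit.
Unset Printing Implicit Defensive.

Import Order.TTheory GRing.Theory Num.Theory.
Import numFieldNormedType.Exports.

Local Open Scope classical_set_scope.
Local Open Scope ring_scope.

(* The sigma-algebra on 'rV[T]_n generated by the coordinates, as the library
   does for n.-tuple T; over the reals it is the Borel sigma-algebra. *)

Definition measure_rV_display : measure_display -> measure_display.
Proof. exact. Qed.

Section measurable_rV.
Context {disp} {T : sigmaRingType disp}.
Variable n : nat.

Let coors : 'I_n -> 'rV[T]_n -> T := fun i x => x ord0 i.

Let rV_set0 : g_sigma_preimage coors set0.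
Proof. exact: sigma_algebra0. Qed.

Let rV_setC A : g_sigma_preimage coors A -> g_sigma_preimage coors (~` A).
Proof. exact: sigma_algebraC. Qed.

Let rV_bigcup (F : (set 'rV[T]_n)^nat) :
  (forall i, g_sigma_preimage coors (F i)) ->
  g_sigma_preimage coors (\bigcup_i (F i)).
Proof. exact: sigma_algebra_bigcup. Qed.

HB.instance Definition _ := @isMeasurable.Build (measure_rV_display disp)
  'rV[T]_n (g_sigma_preimage coors) rV_set0 rV_setC rV_bigcup.

End measurable_rV.

Section measurable_rV_lemmas.
Context d1 d2 (T1 : measurableType d1) (T2 : measurableType d2).

Lemma measurable_coord n (i : 'I_n) :
  measurable_fun [set: 'rV[T2]_n] (fun x : 'rV[T2]_n => x ord0 i).
Proof.
move=> _ Y mY; rewrite setTI; apply: sub_sigma_algebra => /=.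
rewrite -bigcup_seq/=; exists i => /=; first by rewrite mem_index_enum.
by exists Y => //; rewrite setTI.
Qed.

Lemma measurable_fun_rV n (f : T1 -> 'rV[T2]_n) :
  (forall i, measurable_fun [set: T1] (fun x => f x ord0 i)) ->
  measurable_fun [set: T1] f.
Proof.
move=> mf.
suff H : g_sigma_preimage (fun i x => f x ord0 i) `<=` measurable.
  move=> _ A mA; apply: H.
  rewrite (_ : (fun i x => f x ord0 i) =
    (fun i => (fun v : 'rV[T2]_n => v ord0 i) \o f)) //.
  by rewrite g_sigma_preimage_comp; exists A.
apply: smallest_sub; first exact: sigma_algebra_measurable.
rewrite -bigcup_seq; apply: bigcup_sub => i _.
by move=> A [B mB <-]; exact: mf.
Qed.

End measurable_rV_lemmas.

(* Lebesgue measure on 'rV[R]_n, by induction on n: the image of the product of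
   the one-dimensional Lebesgue measure with the n-dimensional one. *)

Section lebesgue_rV.
Variable R : realType.

Definition rV_cons n (p : measurableTypeR R * 'rV[R]_n) : 'rV[R]_n.+1 :=
  \row_i oapp (p.2 ord0) p.1 (unlift ord0 i).

Lemma measurable_rV_cons n : measurable_fun setT (@rV_cons n).
Proof.
apply: measurable_fun_rV => i.
rewrite /rV_cons; case: (unliftP ord0 i) => [j ->|->].
  rewrite (_ : (fun x => _) = (fun p : measurableTypeR R * 'rV[R]_n => p.2 ord0 j)).
    exact: (measurableT_comp (measurable_coord j)).
  by apply/funext => p; rewrite mxE liftK.
rewrite (_ : (fun x => _) = fst) //.
by apply/funext => p; rewrite mxE unlift_none.
Qed.

Section step.
Variables (n : nat) (mu : {sigma_finite_measure set 'rV[R]_n -> \bar R}).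

Definition lebesgue_step : set 'rV[R]_n.+1 -> \bar R :=
  pushforward (@lebesgue_measure R \x mu)%E (@rV_cons n).

Let step_measure : {measure set 'rV[R]_n.+1 -> \bar R} :=
  measure_function_pushforward__canonical__measure_function_Measure
    (@lebesgue_measure R \x mu)%E (@measurable_rV_cons n).

HB.instance Definition _ := Measure.copy lebesgue_step step_measure.

Let product_sigma_finite : sigma_finite setT (@lebesgue_measure R \x mu)%E.
Proof.
have /sigma_finiteP[F [TF ndF Foo]] := sigma_finiteT (@lebesgue_measure R).
have /sigma_finiteP[G [TG ndG Goo]] := sigma_finiteT mu.
exists (fun k => F k `*` G k).
  rewrite -setXTT TF TG predeqE => -[x y]; split.
    move=> [/= [i _ Fix] [j _ Gjy]]; exists (maxn i j) => //; split.
    - by move: x Fix; exact/subsetPset/ndF/leq_maxl.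
    - by move: y Gjy; exact/subsetPset/ndG/leq_maxr.
  by move=> [i _ []/= ? ?]; split; exists i.
move=> k; have [? ?] := Foo k; have [? ?] := Goo k.
split; first exact: measurableX.
by rewrite product_measure1E// lte_mul_pinfty// ge0_fin_numE.
Qed.

Let step_sigma_finite : sigma_finite setT lebesgue_step.
Proof.
have [F FT Foo] := product_sigma_finite.
pose uncons (v : 'rV[R]_n.+1) : measurableTypeR R * 'rV[R]_n :=
  (v ord0 ord0, \row_j v ord0 (lift ord0 j)).
have consK : cancel (@rV_cons n) uncons.
  move=> [t v]; rewrite /uncons /rV_cons mxE unlift_none /=; congr pair.
  by apply/rowP => j; rewrite !mxE liftK.
have muncons : measurable_fun setT uncons.
  apply/measurable_fun_pair; first exact: measurable_coord.
  apply: measurable_fun_rV => j.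
  rewrite (_ : (fun x => _) = fun x : 'rV[R]_n.+1 => x ord0 (lift ord0 j)).
    exact: measurable_coord.
  by apply/funext => x; rewrite mxE.
exists (fun k => uncons @^-1` F k).
  by rewrite -preimage_bigcup -FT.
move=> k; have [mFk Fkoo] := Foo k; split.
  by rewrite -[X in measurable X]setTI; exact: muncons.
rewrite /lebesgue_step /pushforward -comp_preimage.
rewrite (_ : uncons \o _ = id) ?preimage_id //.
by apply/funext => p; exact: consK.
Qed.

HB.instance Definition _ := Measure_isSigmaFinite.Build _ _ _ lebesgue_step
  step_sigma_finite.

End step.

Fixpoint lebesgue_rV n : {sigma_finite_measure set 'rV[R]_n -> \bar R} :=
  match n with
  | 0 => [the {sigma_finite_measure set 'rV[R]_0 -> \bar R}
          of dirac (0 : 'rV[R]_0)]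
  | n'.+1 => [the {sigma_finite_measure set _ -> \bar R}
              of lebesgue_step (lebesgue_rV n')]
  end.

Lemma lebesgue_rV_box n (A : 'I_n -> set (measurableTypeR R)) :
  (forall i, measurable (A i)) ->
  lebesgue_rV n [set x : 'rV[R]_n | forall i, A i (x ord0 i)] =
  (\prod_(i < n) lebesgue_measure (A i))%E.
Proof.
elim: n A => [|n IH] A mA /=.
  by rewrite big_ord0 diracE mem_set //= => -[].
rewrite big_ord_recl -IH // -product_measure1E //; last first.
  rewrite (_ : [set x | _] =
      \bigcap_(i in [set: 'I_n]) (fun x : 'rV[R]_n => x ord0 i) @^-1` A (lift ord0 i)).
    apply: fin_bigcap_measurable => //.
    move=> i _; rewrite -[X in measurable X]setTI.
    by apply: measurable_coord => //; exact: mA.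
  by apply/seteqP; split=> [x Ax i _ //|x Ax i]; exact: Ax.
rewrite /lebesgue_step /pushforward; congr product_measure1.
apply/seteqP; split=> [[t v] /= H|[t v] /= [At Av] i].
  split; first by have := H ord0; rewrite /rV_cons mxE unlift_none.
  by move=> i; have := H (lift ord0 i); rewrite /rV_cons mxE liftK.
rewrite /rV_cons mxE; case: (unliftP ord0 i) => [j ->|->] //=.
Qed.

End lebesgue_rV.

Section euclidean.
Context {R : realType} {d : nat}.
Implicit Types x y v : 'rV[R]_d.

Definition dotv x y : R := \sum_(i < d) x ord0 i * y ord0 i.

(* The library norm on 'rV[R]_d is the sup norm. *)
Definition enorm x : R := Num.sqrt (dotv x x).

Definition eball (r : R) : set 'rV[R]_d := [set x | enorm x < r].

End euclidean.

Section convex_analysis.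
Context {R : realType} {d : nat}.
Implicit Types (x y v : 'rV[R]_d) (phi : 'rV[R]_d -> \bar R).
Local Open Scope ereal_scope.

Definition proper phi : Prop :=
  (forall x, -oo < phi x) /\ (exists x, phi x < +oo).

Definition econvex phi : Prop := forall x y (t : R), (0 < t < 1)%R ->
  phi (t *: x + (1 - t) *: y)%R <= t%:E * phi x + (1 - t)%:E * phi y.

Definition Gamma0 phi : Prop :=
  [/\ proper phi, lower_semicontinuous phi & econvex phi].

Definition conjugate phi : 'rV[R]_d -> \bar R := fun y =>
  ereal_sup [set (dotv x y)%:E - phi x | x in [set: 'rV[R]_d]].

Definition subdifferential phi x : set 'rV[R]_d :=
  [set v | forall y, phi x + (dotv v (y - x))%:E <= phi y].

Definition is_gradient phi x v : Prop :=
  [/\ \forall y \near x, phi y \is a fin_num,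
      differentiable (fine \o phi) x &
      forall h, 'd (fine \o phi) x h = dotv v h].

(* Total function: 0 at the points where phi has no gradient.  An optimal
   Brenier potential is differentiable mu-almost everywhere when mu has a
   density. *)
Definition gradient phi x : 'rV[R]_d := xget 0%R [set v | is_gradient phi x v].

End convex_analysis.

Section measures.
Context {R : realType} {d : nat}.
Implicit Types mu nu : probability 'rV[R]_d R.
Local Open Scope ereal_scope.

Definition msupport mu : set 'rV[R]_d :=
  [set x | forall U : set 'rV[R]_d, open U -> U x -> 0 < mu U].

Definition compactly_supported_in mu (A : set 'rV[R]_d) : Prop :=
  compact (msupport mu) /\ msupport mu `<=` A.

Definition has_density_bounded_by mu (M : R) : Prop :=
  exists f : 'rV[R]_d -> R,
    [/\ measurable_fun setT f, forall x, (0 <= f x <= M)%R &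
        forall A, measurable A ->
          mu A = \int[lebesgue_rV R d]_(x in A) (f x)%:E].

Definition brenier_objective mu nu (phi : 'rV[R]_d -> \bar R) : \bar R :=
  \int[mu]_x phi x + \int[nu]_y conjugate phi y.

Definition optimal_brenier_potential mu nu (phi : 'rV[R]_d -> \bar R) : Prop :=
  Gamma0 phi /\
  forall psi, Gamma0 psi ->
    brenier_objective mu nu phi <= brenier_objective mu nu psi.

End measures.

Section monge_map_estimator.
Context {R : realType} {d n m : nat}.
Variables (a : 'I_n -> R) (x : 'I_n -> 'rV[R]_d).
Variables (b : 'I_m -> R) (y : 'I_m -> 'rV[R]_d).

Definition dual_feasible (f : 'I_n -> R) (g : 'I_m -> R) : Prop :=
  forall i j, f i + g j <= 2^-1 * enorm (x i - y j) ^+ 2.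

Definition dual_value (f : 'I_n -> R) (g : 'I_m -> R) : R :=
  \sum_(i < n) f i * a i + \sum_(j < m) g j * b j.

Definition dual_optimal (f : 'I_n -> R) (g : 'I_m -> R) : Prop :=
  dual_feasible f g /\
  forall f' g', dual_feasible f' g' -> dual_value f' g' <= dual_value f g.

Definition dual_potential (g : 'I_m -> R) (z : 'rV[R]_d) : \bar R :=
  \big[maxe/-oo%E]_(k < m) (dotv z (y k) + g k - 2^-1 * enorm (y k) ^+ 2)%:E.

(* Any selection of subgradients, for any optimal pair of dual potentials. *)
Definition monge_map_estimator (T : 'rV[R]_d -> 'rV[R]_d) : Prop :=
  exists f g, dual_optimal f g /\
    forall z, subdifferential (dual_potential g) z (T z).

End monge_map_estimator.

Section sampling.
Context {R : realType} {d : nat}.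
Context {dO : measure_display} {Omega : measurableType dO}.
Variable P : probability Omega R.
Local Open Scope ereal_scope.

Definition mutually_independent n (X : 'I_n -> {RV P >-> 'rV[R]_d}) : Prop :=
  forall (J : {set 'I_n}) (A : 'I_n -> set 'rV[R]_d),
    (forall i, measurable (A i)) ->
    P (\bigcap_(i in [set` J]) X i @^-1` A i) = \prod_(i in J) P (X i @^-1` A i).

Definition iid_sample n (X : 'I_n -> {RV P >-> 'rV[R]_d})
    (mu : probability 'rV[R]_d R) : Prop :=
  mutually_independent X /\
  forall i A, measurable A -> P (X i @^-1` A) = mu A.

End sampling.

Definition rate (R : realType) (d n m : nat) : R :=
  if d == 1%N then
    (n%:R `^ (- 2^-1) + m%:R `^ (- 2^-1)) `^ 4^-1
  else if d == 2%N then
    (n%:R `^ (- 2^-1) * ln (1 + n%:R) + m%:R `^ (- 2^-1) * ln (1 + m%:R)) `^ 4^-1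
  else
    (n%:R `^ (- d%:R^-1) + m%:R `^ (- d%:R^-1)) `^ 4^-1.

(* Main.v *)
Require Import Defs.
From HB Require Import structures.
From mathcomp Require Import all_boot all_order all_algebra.
From mathcomp Require Import all_classical all_reals all_analysis.
From mathcomp Require Import measurable_realfun ring lra.

(** Write F for the estimated potential and chi for its conjugate restricted to
    the ball of radius r + 1, and let the gap be the integral of F against mu
    plus that of chi against nu, minus the optimal value of the objective.

    The gap controls the gradients. Compare phi with the conjugate of
    (1 - t) phi^* + t chi, divide by t and let t tend to 0: since phi has a
    gradient mu-almost everywhere, Fatou's lemma yields a function E whose
    mu-integral is at most the gap and such that
    <grad phi x, b - x> + F x - F b <= E x for the points b near x
    ([duality_gap]). A subgradient T x of F satisfies
    F x - <T x, b - x> <= F (2 x - b). Taking b = x + h e_i and b = x - h e_i,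
    the i-th coordinate of h (grad phi x - T x) is at most E x plus the second
    difference of F at x with step h e_i. As F is Lipschitz, this second
    difference has a Lebesgue integral of order h^2 over a cube
    ([integral_second_difference_le]), although it is only of order h pointwise.
    Hence the mean error is at most a constant times gap / h + h
    ([gradient_stability]), for every deterministic h.

    The gap is small in expectation. On the sample, optimality of the discrete
    dual solution says that (F, chi) does at least as well as phi paired with
    phi^* ([empirical_objective_le]), and the empirical objective of the latter
    pair has the optimal value as expectation. Both F and chi are Lipschitz with constants
    depending on r alone, so that passing from empirical to true averages costs
    a random variable, uniform in the Lipschitz function, whose expectation is
    of order s as soon as 1 <= n s^(d + 2). A grid with a single mesh is enough
    for this ([empirical_lipschitz_deviation]).

    With s = n^(- 1 / (2 q)), where q = d for d > 1 and q = 2 for d = 1, and h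
    of the order of the square root of the sum of the two scales, the bound is
    of the order of (n^(- 1 / q) + m^(- 1 / q))^(1 / 4).

    The estimator need not depend measurably on the sample. All upper bounds of
    the integrand are measurable, and the integral is monotone on arbitrary
    functions ([le_integral_off_null]). *)

Set Implicit Arguments.
Unset Strict Implicit.
Unset Printing Implicit Defensive.

Import Order.TTheory GRing.Theory Num.Theory.
Import numFieldNormedType.Exports.

Local Open Scope classical_set_scope.
Local Open Scope ring_scope.

(** * Euclidean geometry of row vectors *)

Section euclidean_geometry.
Context {R : realType} {d : nat}.
Implicit Types (x y v : 'rV[R]_d) (i : 'I_d).

Lemma dotvC x y : dotv x y = dotv y x.
Proof. by apply: eq_bigr => i _; rewrite mulrC. Qed.

Lemma dotvDl x y v : dotv (x + y) v = dotv x v + dotv y v.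
Proof. by rewrite -big_split; apply: eq_bigr => i _; rewrite mxE mulrDl. Qed.

Lemma dotvZl (a : R) x v : dotv (a *: x) v = a * dotv x v.
Proof. by rewrite mulr_sumr; apply: eq_bigr => i _; rewrite mxE mulrA. Qed.

Lemma dotvDr x y v : dotv v (x + y) = dotv v x + dotv v y.
Proof. by rewrite dotvC dotvDl !(dotvC v). Qed.

Lemma dotvZr (a : R) x v : dotv v (a *: x) = a * dotv v x.
Proof. by rewrite dotvC dotvZl dotvC. Qed.

Lemma dotvNr x v : dotv v (- x) = - dotv v x.
Proof. by rewrite -scaleN1r dotvZr mulN1r. Qed.

Lemma dotvBr x y v : dotv v (x - y) = dotv v x - dotv v y.
Proof. by rewrite dotvDr dotvNr. Qed.

Lemma dotvBl x y v : dotv (x - y) v = dotv x v - dotv y v.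
Proof. by rewrite dotvC dotvBr !(dotvC v). Qed.

Lemma dotv0 v : dotv v 0 = 0.
Proof. by rewrite -(scale0r (0 : 'rV[R]_d)) dotvZr mul0r. Qed.

Lemma dotv_delta i v : dotv v (delta_mx 0 i) = v ord0 i.
Proof.
rewrite /dotv (bigD1 i)//= big1 ?addr0 => [|j ji]; rewrite mxE eqxx/=.
  by rewrite mulr1.
by rewrite (negbTE ji) mulr0.
Qed.

Lemma dotvv_ge0 x : 0 <= dotv x x.
Proof. by apply: sumr_ge0 => i _; rewrite -expr2 sqr_ge0. Qed.

Lemma enorm_ge0 x : 0 <= enorm x.
Proof. exact: sqrtr_ge0. Qed.

Lemma sqr_enorm x : enorm x ^+ 2 = dotv x x.
Proof. by rewrite sqr_sqrtr// dotvv_ge0. Qed.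

Lemma sqr_enormB x y :
  enorm (x - y) ^+ 2 = enorm x ^+ 2 - 2 * dotv x y + enorm y ^+ 2.
Proof. by rewrite !sqr_enorm !(dotvBl, dotvBr) (dotvC y x); ring. Qed.

Lemma enormN x : enorm (- x) = enorm x.
Proof. by rewrite /enorm dotvNr dotvC dotvNr opprK. Qed.

Lemma enormZ (a : R) x : enorm (a *: x) = `|a| * enorm x.
Proof.
by rewrite /enorm dotvZl dotvZr mulrA -expr2 sqrtrM ?sqr_ge0// sqrtr_sqr.
Qed.

Lemma enorm0 : enorm (0 : 'rV[R]_d) = 0.
Proof. by rewrite /enorm dotv0 sqrtr0. Qed.

Lemma cauchy_schwarz x y : dotv x y <= enorm x * enorm y.
Proof.
have y0 : 0 <= enorm y := enorm_ge0 y.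
have x0 : 0 <= enorm x := enorm_ge0 x.
have h := dotvv_ge0 (enorm y *: x - enorm x *: y).
have [xy0|xy0] := ltP 0 (enorm x * enorm y).
  rewrite -(ler_pM2l xy0).
  move: h; rewrite !(dotvBl, dotvBr, dotvZl, dotvZr) -!sqr_enorm (dotvC y x).
  by nra.
have /eqP : enorm x * enorm y = 0 by apply/eqP; rewrite eq_le xy0 mulr_ge0.
have null v : enorm v = 0 -> v = 0.
  move=> v0; have := sqr_enorm v; rewrite v0 expr0n/= => /esym/psumr_eq0P v00.
  apply/rowP => i; rewrite mxE; apply/eqP; rewrite -sqrf_eq0 expr2 v00//.
  by move=> j _; rewrite -expr2 sqr_ge0.
rewrite mulf_eq0 => /orP[] /eqP/null ->; last by rewrite dotv0 enorm0 mulr0.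
by rewrite dotvC dotv0 enorm0 mul0r.
Qed.

Lemma ler_enormD x y : enorm (x + y) <= enorm x + enorm y.
Proof.
have h := cauchy_schwarz x y.
rewrite -(@ler_pXn2r _ 2)// ?nnegrE ?addr_ge0 ?enorm_ge0// sqr_enorm.
by rewrite dotvDl !dotvDr -!sqr_enorm (dotvC y x); nra.
Qed.

Lemma ler_coord_enorm x i : `|x ord0 i| <= enorm x.
Proof.
rewrite -(@ler_pXn2r _ 2)// ?nnegrE ?enorm_ge0// sqr_enorm real_normK ?num_real//.
rewrite /dotv (bigD1 i)//= -expr2 lerDl sumr_ge0// => j _.
by rewrite -expr2 sqr_ge0.
Qed.

Lemma enorm_delta i : enorm (delta_mx 0 i : 'rV[R]_d) = 1.
Proof. by rewrite /enorm dotv_delta mxE !eqxx sqrtr1. Qed.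

Lemma ler_enorm_sum x : enorm x <= \sum_(i < d) `|x ord0 i|.
Proof.
suff {1}-> : x = \sum_(i < d) x ord0 i *: delta_mx 0 i.
  elim/big_ind2 : _ => [|a b u v ab uv|i _]; first by rewrite enorm0.
    by rewrite (le_trans (ler_enormD _ _))// lerD.
  by rewrite enormZ enorm_delta mulr1.
exact: row_sum_delta.
Qed.

Lemma ler_enorm_norm x : enorm x <= d%:R * `|x|.
Proof.
apply: (le_trans (ler_enorm_sum x)).
rewrite mulr_natl -[X in _ *+ X]card_ord -sumr_const ler_sum// => i _.
have : `|x| = mx_norm x by [].
by rewrite mx_normrE => ->; exact: (le_bigmax _ _ (ord0, i)).
Qed.

(** The sup norm and the Euclidean norm are comparable, hence a Lipschitz
    condition for the latter gives continuity for the ambient topology. *)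
Lemma lipschitz_enorm_continuous (F : 'rV[R]_d -> R) (L : R) :
  (forall x y, F x - F y <= L * enorm (x - y)) -> continuous F.
Proof.
move=> FL.
have L0 : 0 < `|L| * d%:R + 1 by rewrite ltr_wpDl// mulr_ge0.
have FL' x y : `|F x - F y| <= (`|L| * d%:R + 1) * `|x - y|.
  suff FB u v : F u - F v <= (`|L| * d%:R + 1) * `|u - v|.
    by rewrite ler_norml FB lerNl opprB distrC FB.
  apply: (le_trans (FL u v)); rewrite mulrDl mul1r -mulrA.
  rewrite (@le_trans _ _ (`|L| * enorm (u - v)))// ?ler_wpM2r ?enorm_ge0//.
    exact: ler_norm.
  by rewrite -[leLHS]addr0 lerD// ler_wpM2l// ler_enorm_norm.
move=> x A /nbhs_ballP[e /= e0 eA]; apply/nbhs_ballP.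
exists (e / (`|L| * d%:R + 1)); first exact: divr_gt0.
move=> y; rewrite -ball_normE /= ltr_pdivlMr// mulrC => xy; apply: eA.
by rewrite -ball_normE /=; exact: le_lt_trans (FL' x y) xy.
Qed.

Lemma continuous_dotvr v : continuous (fun x => dotv x v).
Proof.
apply: (@lipschitz_enorm_continuous _ (enorm v)) => x y.
by rewrite -dotvBl mulrC cauchy_schwarz.
Qed.

Lemma continuous_enorm : continuous (@enorm R d).
Proof.
apply: (@lipschitz_enorm_continuous _ 1) => x y.
by rewrite mul1r lerBlDr -[x in enorm x <= _](subrK y) ler_enormD.
Qed.

End euclidean_geometry.

(** * Borel sets and the support *)

Section borel_sets.
Context {R : realType} {d : nat}.

(** Lindelof property with measurable pieces: a union of open sets is a
    countable union of cubes with rational centers, each one contained in some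
    member of the family; cubes are measurable because coordinates are. *)
Lemma countable_measurable_refinement (C : set (set 'rV[R]_d)) :
  (forall U, C U -> open U) ->
  exists F : nat -> set 'rV[R]_d,
  [/\ forall n, measurable (F n),
      forall n, F n = set0 \/ exists2 U, C U & F n `<=` U &
      \bigcup_(U in C) U = \bigcup_n F n].
Proof.
move=> oC.
pose cube (c : 'rV[rat]_d * nat) : set 'rV[R]_d :=
  [set y | forall i, `|y ord0 i - ratr (c.1 ord0 i)| < c.2.+1%:R^-1].
have mcube c : measurable (cube c).
  rewrite (_ : cube c = \bigcap_(i in [set: 'I_d]) (fun y : 'rV[R]_d => y ord0 i)
      @^-1` (ball (ratr (c.1 ord0 i) : R) c.2.+1%:R^-1)).
    apply: fin_bigcap_measurable => // i _; rewrite -[X in measurable X]setTI.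
    by apply: measurable_coord => //; exact: measurable_ball.
  apply/seteqP; split => y /= yc i; [move=> _|]; have := yc i;
  by rewrite /ball/= distrC //; apply.
pose small c := `[< exists2 U, C U & cube c `<=` U >].
pose F n := if @unpickle ('rV[rat]_d * nat)%type n is Some c then
  (if small c then cube c else set0) else set0.
exists F; split => [n|n|]; rewrite /F.
- by case: unpickle => // c; case: ifP.
- case: unpickle => [c|]; last by left.
  by case: ifP => [/asboolP|]; [right|left].
apply/seteqP; split => [x [U CU Ux]|x [n _]]; last first.
  by case: unpickle => // c; case: ifP => // /asboolP[U CU cU] /cU; exists U.
have [e /= e0 xeU] : nbhs_ball x U.
  by apply/nbhs_ballP; apply: open_nbhs_nbhs; split=> //; exact: oC.
have [k ke] : exists k : nat, k.+1%:R^-1 < e / 2.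
  by have [k] := ltr_add_invr (divr_gt0 e0 (ltr0n _ 2)); rewrite add0r; exists k.
have k0 : 0 < k.+1%:R^-1 :> R by rewrite invr_gt0.
have /choice[q qx] i : exists q : rat, `|x ord0 i - ratr q| < k.+1%:R^-1.
  have /rat_in_itvoo[q] : x ord0 i - k.+1%:R^-1 < x ord0 i + k.+1%:R^-1.
    by rewrite ltrD2l gtrN.
  by rewrite in_itv/= => qx; exists q; rewrite ltr_distlC.
exists (pickle (\row_i q i, k)) => //; rewrite pickleK (_ : small _).
  by move=> i /=; rewrite mxE.
apply/asboolP; exists U => // y /= yq; apply: xeU; split => // a i.
have -> : a = ord0 by exact: ord1.
have xy : `|x ord0 i - y ord0 i| < e.
  rewrite (splitr e) (le_lt_trans (ler_distD (ratr (q i)) _ _))// ltrD//.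
    exact: lt_trans (qx i) ke.
  by rewrite distrC; have := yq i; rewrite /= mxE => /lt_trans; exact.
exact: xy.
Qed.

Lemma open_measurable_rV (U : set 'rV[R]_d) : open U -> measurable U.
Proof.
move=> oU; have [_ ->//|F [mF _ UF]] := @countable_measurable_refinement [set U].
by rewrite -(bigcup_set1 id U) UF; exact: bigcupT_measurable.
Qed.

Lemma lower_semicontinuous_measurable_rV (f : 'rV[R]_d -> \bar R) :
  lower_semicontinuous f -> measurable_fun [set: 'rV[R]_d] f.
Proof.
move=> scif; apply: (measurability _ (ErealGenOInfty.measurableE R)).
move=> /= _ [_ [a ->]] <-; apply: measurableI => //; apply: open_measurable_rV.
by rewrite preimage_itvoy; move/lower_semicontinuousP : scif; exact.
Qed.

Lemma continuous_measurable_rV (f : 'rV[R]_d -> R) :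
  continuous f -> measurable_fun [set: 'rV[R]_d] f.
Proof.
move=> cf; apply: (measurability _ (RGenOpens.measurableE R)).
move=> /= _ [_ [a [b ->]] <-]; apply: measurableI => //.
by apply: open_measurable_rV; apply: open_comp => //; exact: interval_open.
Qed.

Lemma measurable_eball (r : R) : measurable (eball r : set 'rV[R]_d).
Proof.
rewrite -[X in measurable X]setTI (_ : eball r = enorm @^-1` `]-oo, r[%classic).
  by apply: continuous_measurable_rV => //; exact: continuous_enorm.
by apply/seteqP; split => x; rewrite /eball/= in_itv.
Qed.

(** The complement of the support is covered by null open sets, countably many
    of which suffice. *)
Lemma msupport_full (mu : probability 'rV[R]_d R) (A : set 'rV[R]_d) :
  measurable A -> msupport mu `<=` A -> mu (~` A) = 0%E.
Proof.
move=> mA sA.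
have [U [//]|F [mF FU EF]] := @countable_measurable_refinement
  [set U : set 'rV[R]_d | open U /\ mu U = 0%E].
apply/measure_negligible; first exact: measurableC.
apply: (@negligibleS _ _ _ mu (\bigcup_n F n)).
  rewrite -EF => x /= Ax; apply: contrapT => xF; apply/Ax/sA => U oU Ux.
  rewrite lt0e measure_ge0 andbT; apply/eqP => U0.
  by apply: xF; exists U.
apply: negligible_bigcup => n; have [->|[U [oU U0] FU']] := FU n.
  exact: negligible_set0.
by exists U; split => //; exact: open_measurable_rV.
Qed.

End borel_sets.

(** * Lebesgue measure on row vectors *)

Section lebesgue_translation.
Context {R : realType}.
Local Open Scope ereal_scope.

Lemma measurable_shift_rV n (v : 'rV[R]_n) :
  measurable_fun [set: 'rV[R]_n] (fun x : 'rV[R]_n => (x + v)%R).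
Proof.
apply: measurable_fun_rV => i.
rewrite (_ : (fun x => _) = (fun x : 'rV[R]_n => x ord0 i + v ord0 i)%R).
  by apply: measurable_funD => //; exact: measurable_coord.
by apply/funext => x; rewrite mxE.
Qed.

Lemma lebesgue_measure_shift (a : R) (A : set (measurableTypeR R)) :
  measurable A -> lebesgue_measure ((fun x => (x + a)%R) @^-1` A) = lebesgue_measure A.
Proof.
move=> mA; apply/esym.
pose shift (x : measurableTypeR R) : measurableTypeR R := (x + a)%R.
have mshift : measurable_fun [set: measurableTypeR R] shift.
  by apply: measurable_funD.
pose m' : {measure set (measurableTypeR R) -> \bar R} :=
  measure_function_pushforward__canonical__measure_function_Measure
    (@lebesgue_measure R) mshift.
rewrite (lebesgue_measure_unique (mu := m')) // => X /ocitvP[->|[[b c] /= bc ->]].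
  by rewrite !measure0.
rewrite /pushforward (_ : _ @^-1` _ = `](b - a)%R, (c - a)%R]%classic).
  rewrite !lebesgue_measure_itv/= !lte_fin bc ltrD2r bc -!EFinD; congr EFin; ring.
by apply/seteqP; split => x; rewrite /= !in_itv/= ltrBlDr lerBrDr.
Qed.

(** The recursive definition is a product with the one-dimensional measure, and
    a product measure is determined by its values on rectangles. *)
Lemma lebesgue_rV_shift n (v : 'rV[R]_n) (A : set 'rV[R]_n) : measurable A ->
  lebesgue_rV R n ((fun x => (x + v)%R) @^-1` A) = lebesgue_rV R n A.
Proof.
elim: n v A => [|n IH] v A mA.
  by congr (lebesgue_rV R 0 _); apply/seteqP; split => x; rewrite /= !thinmx0.
pose w : 'rV[R]_n := \row_j v ord0 (lift ord0 j).
pose shift (p : measurableTypeR R * 'rV[R]_n) : measurableTypeR R * 'rV[R]_n :=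
  ((p.1 + v ord0 ord0)%R, (p.2 + w)%R).
have mshift : measurable_fun setT shift.
  apply/measurable_fun_pair; first by apply: measurable_funD.
  exact: (measurableT_comp (measurable_shift_rV w)).
rewrite /= /lebesgue_step /pushforward.
have mA' : measurable (@rV_cons R n @^-1` A).
  by rewrite -[X in measurable X]setTI; exact: measurable_rV_cons.
rewrite (product_measure_unique
  (m' := measure_function_pushforward__canonical__measure_function_Measure
    (@lebesgue_measure R \x lebesgue_rV R n) mshift) _ mA').
  rewrite /pushforward; congr (product_measure1 _ _ _).
  apply/seteqP; split => -[t x] /=; rewrite /rV_cons /=;
  set y := (X in A X) => Ay; set z := (X in A X); suff <- : y = z by [].
  - by apply/rowP => i; rewrite !mxE; case: unliftP => [j|] ->; rewrite /= ?mxE.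
  - by apply/rowP => i; rewrite !mxE; case: unliftP => [j|] ->; rewrite /= ?mxE.
move=> B C mB mC; rewrite /= /pushforward -(IH w C)// -(lebesgue_measure_shift (v ord0 ord0) mB).
rewrite -product_measure1E//; last 2 first.
- by rewrite -[X in measurable X]setTI; apply: measurable_funD.
- by rewrite -[X in measurable X]setTI; exact: measurable_shift_rV.
Qed.

End lebesgue_translation.

Section lebesgue_estimates.
Context {R : realType} {d : nat}.
Local Notation leb := (lebesgue_rV R d).
Implicit Types (x v : 'rV[R]_d) (i : 'I_d).
Local Open Scope ereal_scope.

Definition cube (l : R) : set 'rV[R]_d := [set x | forall i, `|x ord0 i| <= l]%R.

Lemma measurable_box (A : 'I_d -> set (measurableTypeR R)) :
  (forall i, measurable (A i)) ->
  measurable [set x : 'rV[R]_d | forall i, A i (x ord0 i)].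
Proof.
move=> mA; rewrite (_ : [set x | _] =
    \bigcap_(i in [set: 'I_d]) (fun x : 'rV[R]_d => x ord0 i) @^-1` A i).
  apply: fin_bigcap_measurable => // i _; rewrite -[X in measurable X]setTI.
  by apply: measurable_coord => //; exact: mA.
by apply/seteqP; split=> [x Ax i _ //|x Ax i]; exact: Ax.
Qed.

Lemma cube_itv l : cube l = [set x | forall i, `[(- l)%R, l]%classic (x ord0 i)].
Proof. by apply/seteqP; split => x xl i; have := xl i; rewrite /= in_itv/= ler_norml. Qed.

Lemma measurable_cube l : measurable (cube l).
Proof. by rewrite cube_itv; apply: (measurable_box (fun=> measurable_itv _)). Qed.

Lemma lebesgue_cube_lty l : leb (cube l) < +oo.
Proof.
rewrite cube_itv (lebesgue_rV_box (fun=> measurable_itv _)).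
suff : \prod_(i < d) lebesgue_measure `[(- l)%R, l]%classic \is a fin_num.
  by move=> /fin_numPlt/andP[].
elim/big_ind : _ => // [x y|i _]; first exact: fin_numM.
by rewrite lebesgue_measure_itv/=; case: ifP.
Qed.

(** Infinitely many disjoint translates, by short vectors, of a bounded piece of
    N fit in a cube of finite measure, and they all have the same measure. *)
Lemma lebesgue_null_of_disjoint_shifts (N : set 'rV[R]_d) v :
  measurable N ->
  (forall x (t : R), N x -> (0 < t)%R -> ~ N (x + t *: v)%R) -> leb N = 0.
Proof.
move=> mN dNp.
have dN x (t : R) : N x -> t != 0%R -> ~ N (x + t *: v)%R.
  rewrite neq_lt => Nx /orP[t0 Nxt|/dNp]; last exact.
  by apply: (dNp _ (- t)%R Nxt); rewrite ?oppr_gt0// scaleNr addrK.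
have mS (t : R) (B : set 'rV[R]_d) : measurable B -> measurable ((fun x => x + t *: v)%R @^-1` B).
  by move=> mB; rewrite -[X in measurable X]setTI; exact: measurable_shift_rV.
pose B k := N `&` cube k%:R.
have mB k : measurable (B k) by apply: measurableI => //; exact: measurable_cube.
suff B0 k : leb (B k) = 0.
  apply/measure_negligible => //.
  apply: (@negligibleS _ _ _ leb (\bigcup_k B k)).
    move=> x Nx; have [k xk] : exists k, (`|x| < k%:R)%R.
      by exists (Num.trunc `|x|).+1; exact: truncnS_gt.
    exists k => //; split => // i; apply: le_trans (ltW xk).
    have -> : `|x|%R = mx_norm x by [].
    by rewrite mx_normrE; exact: (le_bigmax _ _ (ord0, i)).
  by apply: negligible_bigcup => k; apply/negligibleP; [exact: mB|exact: B0].
pose F (j : nat) := (fun x => x + j.+1%:R^-1 *: v)%R @^-1` B k.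
have mF j : measurable (F j) by exact: mS.
have FB j : leb (F j) = leb (B k) by exact: lebesgue_rV_shift.
have tF : trivIset setT F.
  apply/trivIsetP => a b _ _ ab; rewrite -subset0 => x [[/= Na _] [Nb _]].
  apply: (dN _ (b.+1%:R^-1 - a.+1%:R^-1)%R Na).
    rewrite subr_eq0; apply: contra ab => /eqP/invr_inj/eqP.
    by rewrite eqr_nat eqSS eq_sym.
  by rewrite -addrA -scalerDl addrCA subrr addr0.
set K := (k%:R + `|v|)%R.
have FK j : F j `<=` cube K.
  move=> x [_ /= xk] i; have := xk i; rewrite !mxE => xvk.
  rewrite -[x ord0 i](addrK (j.+1%:R^-1 * v ord0 i)%R) (le_trans (ler_normB _ _))//.
  rewrite lerD// normrM.
  rewrite (@le_trans _ _ `|v ord0 i|%R)//.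
    rewrite ler_piMl// ger0_norm ?invr_ge0// invf_le1 ?ltr0n//.
    by rewrite ler1n.
  have -> : `|v|%R = mx_norm v by [].
  by rewrite mx_normrE; exact: (le_bigmax _ _ (ord0, i)).
have Bfin : leb (B k) \is a fin_num.
  rewrite ge0_fin_numE// (le_lt_trans _ (lebesgue_cube_lty k%:R))//.
  by rewrite le_measure ?inE//; [exact: measurable_cube|exact: subIsetr].
have Kfin : leb (cube K) \is a fin_num.
  by rewrite ge0_fin_numE// lebesgue_cube_lty.
have bound m : (m%:R * fine (leb (B k)) <= fine (leb (cube K)))%R.
  rewrite -lee_fin EFinM !fineK//.
  apply: (@le_trans _ _ (leb (\big[setU/set0]_(j < m) F j))); last first.
    rewrite le_measure ?inE//; [exact: bigsetU_measurable|exact: measurable_cube|].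
    by rewrite -bigcup_mkord => x [j _ /FK].
  rewrite measure_semi_additive_ord_I//; last 2 first.
  - by apply: sub_trivIset tF.
  - exact: bigsetU_measurable.
  rewrite (eq_bigr (fun=> leb (B k))) => [|j _]; last exact: FB.
  by rewrite -(fineK Bfin) sumr_const card_ord mule_natl.
rewrite -(fineK Bfin); congr EFin; apply/eqP; rewrite eq_le fine_ge0// andbT.
rewrite leNgt; apply/negP => B0.
have := bound (Num.trunc (fine (leb (cube K)) / fine (leb (B k)))).+1.
by rewrite leNgt -ltr_pdivrMr// truncnS_gt.
Qed.

Lemma lebesgue_integral_shift (g : 'rV[R]_d -> \bar R) v :
  measurable_fun [set: 'rV[R]_d] g -> (forall x, 0 <= g x) ->
  \int[leb]_x g (x + v)%R = \int[leb]_x g x.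
Proof.
move=> mg g0.
pose m' : {measure set 'rV[R]_d -> \bar R} :=
  measure_function_pushforward__canonical__measure_function_Measure
  leb (measurable_shift_rV v).
have <- : \int[m']_x g x = \int[leb]_x g x.
  by apply: eq_measure_integral => A mA _; exact: lebesgue_rV_shift.
rewrite /m'/= ge0_integral_pushforward//; exact: measurable_shift_rV.
Qed.

Definition second_difference (F : 'rV[R]_d -> R) (v x : 'rV[R]_d) : R :=
  (F (x + v) + F (x - v) - 2 * F x)%R.

(** The second difference is D (x + v) - D x with D x = F x - F (x - v) of size
    at most L h; by translation invariance, only the integral of D over a slab
    of thickness h survives. *)
Lemma integral_second_difference_le (F : 'rV[R]_d -> R) (L l h : R) i :
  (0 <= L)%R -> (0 <= l)%R -> (0 <= h)%R ->
  (forall x y, F x - F y <= L * enorm (x - y))%R ->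
  (forall x, 0 <= second_difference F (h *: delta_mx 0 i) x)%R ->
  \int[leb]_(x in cube l) (second_difference F (h *: delta_mx 0 i) x)%:E
  <= (2 * L * (2 * l) ^+ d.-1 * h ^+ 2)%:E.
Proof.
move=> L0 l0 h0 FL; set v := (h *: delta_mx 0 i)%R => D0.
have cF : continuous F := lipschitz_enorm_continuous FL.
have mF := continuous_measurable_rV cF.
have nv : enorm v = h by rewrite enormZ enorm_delta mulr1 ger0_norm.
pose D x := (F x - F (x - v) + L * h)%R.
have Dge0 x : (0 <= D x)%R.
  have := FL (x - v)%R x; rewrite /D addrAC subrr add0r enormN nv; lra.
have Dle x : (D x <= 2 * L * h)%R.
  by have := FL x (x - v)%R; rewrite /D opprB addrCA subrr addr0 nv; lra.
have mD : measurable_fun [set: 'rV[R]_d] D.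
  apply: measurable_funD => //; apply: measurable_funB => //.
  exact: (measurableT_comp mF (measurable_shift_rV (- v))).
have DE x : (D (x + v) = second_difference F v x + D x)%R.
  by rewrite /D /second_difference addrK; ring.
(* the slab by which the translated cube exceeds the cube *)
pose S : set 'rV[R]_d := [set x | forall j, (if j == i then `]l, (l + h)%R]%classic
  else `[(- l)%R, l]%classic) (x ord0 j)].
have mAS j : measurable ((if j == i then `]l, (l + h)%R]%classic
  else `[(- l)%R, l]%classic) : set (measurableTypeR R)) by case: ifP.
have mS : measurable S := measurable_box mAS.
have lebS : leb S <= ((2 * l) ^+ d.-1 * h)%:E.
  rewrite /S (lebesgue_rV_box mAS) (bigD1 i)//= eqxx lebesgue_measure_itv/=.
  rewrite (eq_bigr (fun=> (2 * l)%:E)) => [|j /negbTE ->]; last first.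
    rewrite lebesgue_measure_itv/= lte_fin -EFinD opprK -mulr2n -mulr_natl.
    case: ltP => // ll; congr EFin; lra.
  rewrite prodEFin prodr_const cardC1 card_ord lte_fin.
  case: ifP => _; last by rewrite mul0e lee_fin mulr_ge0// exprn_ge0// mulr_ge0.
  by rewrite -EFinD addrAC subrr add0r -EFinM lee_fin mulrC.
have mI := measurable_cube l.
have mEv : measurable_fun [set: 'rV[R]_d] (fun x => D (x + v)%R).
  exact: (measurableT_comp mD (measurable_shift_rV v)).
have mSD : measurable_fun [set: 'rV[R]_d] (second_difference F v).
  rewrite (_ : second_difference F v = fun x => (D (x + v) - D x)%R).
    exact: measurable_funB.
  by apply/funext => x; rewrite DE addrK.
have fin : \int[leb]_(x in cube l) (D x)%:E \is a fin_num.
  rewrite ge0_fin_numE; last by apply: integral_ge0 => x _; rewrite lee_fin.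
  apply: (@le_lt_trans _ _ (\int[leb]_(x in cube l) (2 * L * h)%:E)).
    apply: ge0_le_integral => //.
    - by move=> x _; rewrite lee_fin.
    - by apply/measurable_EFinP; exact: measurable_funTS.
    - by move=> x _; rewrite lee_fin.
  rewrite integral_cst//; apply: lte_mul_pinfty => //.
    by rewrite lee_fin !mulr_ge0.
  exact: lebesgue_cube_lty.
rewrite -(leeD2rE _ _ fin) -ge0_integralD//; last 4 first.
- by move=> x _; rewrite lee_fin.
- by apply/measurable_EFinP; exact: measurable_funTS.
- by move=> x _; rewrite lee_fin.
- by apply/measurable_EFinP; exact: measurable_funTS.
under eq_integral do rewrite -EFinD -DE.
have mD' A : measurable A -> measurable_fun A (EFin \o D).
  by move=> mA; apply/measurable_EFinP; exact: measurable_funTS.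
have mQv : measurable [set x | cube l (x - v)%R].
  by rewrite -[X in measurable X]setTI; exact: measurable_shift_rV.
have -> : \int[leb]_(x in cube l) (D (x + v)%R)%:E =
    \int[leb]_(x in [set x | cube l (x - v)%R]) (D x)%:E.
  rewrite [RHS]integral_mkcond -[RHS](@lebesgue_integral_shift _ v).
  - rewrite integral_mkcond; apply: eq_integral => x _.
    by rewrite !patchE; congr (if _ then _ else _); apply/idP/idP;
      rewrite !inE/= addrK.
  - by apply/(measurable_restrictT _ mQv); exact: mD'.
  - by move=> x; rewrite patchE; case: ifP => // _; rewrite lee_fin.
apply: (@le_trans _ _ (\int[leb]_(x in cube l `|` S) (D x)%:E)).
  apply: ge0_subset_integral => //.
  - exact: measurableU.
  - by apply: mD'; exact: measurableU.
  - by move=> x _; rewrite lee_fin.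
  move=> x /= Qx; have [xi|xi] := leP (x ord0 i) l; [left => j|right => j];
    have := Qx j; rewrite !mxE/= ?eqxx/=; have [->|ji] := eqVneq j i;
    rewrite ?mulr1 ?mulr0 ?subr0 ?in_itv/= ler_norml => /andP[? ?].
  - by rewrite ler_norml xi andbT; lra.
  - by apply/andP.
  - by rewrite in_itv/= xi/= -lerBlDr.
  - by apply/andP.
rewrite ge0_integral_setU//; last 3 first.
- by apply: mD'; exact: measurableU.
- by move=> x _; rewrite lee_fin.
- apply/disj_set2P/seteqP; split => // x [/= /(_ i) + /(_ i)].
  rewrite eqxx/= in_itv/= ler_norml => /andP[_ xl] /andP[/lt_le_trans/(_ xl)].
  by rewrite ltxx.
rewrite addeC leeD2r//.
apply: (@le_trans _ _ (\int[leb]_(x in S) (2 * L * h)%:E)).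
  apply: ge0_le_integral => //.
  - by move=> x _; rewrite lee_fin.
  - exact: mD'.
  - by move=> x _; rewrite lee_fin.
rewrite integral_cst//; apply: (@le_trans _ _ ((2 * L * h)%:E * ((2 * l) ^+ d.-1 * h)%:E)).
  by rewrite lee_wpmul2l// lee_fin !mulr_ge0.
by rewrite -EFinM lee_fin expr2 le_eqVlt; apply/orP; left; apply/eqP; ring.
Qed.

End lebesgue_estimates.

Section bounded_density.
Context {R : realType} {d : nat} (mu : probability 'rV[R]_d R) (M : R).
Hypotheses (M0 : (0 < M)%R) (muM : has_density_bounded_by mu M).
Local Notation leb := (lebesgue_rV R d).
Local Open Scope ereal_scope.

Lemma bounded_density_le (A : set 'rV[R]_d) : measurable A -> mu A <= M%:E * leb A.
Proof.
have [f [mf f0M muE]] := muM.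
move=> mA; rewrite muE// -integral_cst//.
apply: ge0_le_integral => //.
- by move=> x _; rewrite lee_fin; have /andP[] := f0M x.
- by apply/measurable_EFinP; exact: measurable_funTS.
- by move=> x _; rewrite lee_fin; have /andP[] := f0M x.
Qed.

Lemma bounded_density_null (A : set 'rV[R]_d) : measurable A ->
  leb A = 0 -> mu A = 0.
Proof.
move=> mA A0; apply/eqP; rewrite eq_le measure_ge0 andbT.
by rewrite (le_trans (bounded_density_le mA))// A0 mule0.
Qed.

Lemma bounded_density_integral_le (A : set 'rV[R]_d) (g : 'rV[R]_d -> \bar R) :
  measurable A -> measurable_fun [set: 'rV[R]_d] g -> (forall x, 0 <= g x) ->
  \int[mu]_(x in A) g x <= M%:E * \int[leb]_(x in A) g x.
Proof.
move=> mA mg g0.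
pose M' := NngNum (ltW M0).
rewrite -[M]/(M'%:num%R) -ge0_integral_mscale//; last exact: measurable_funTS.
by apply: ge0_le_measure_integral => // B mB; exact: bounded_density_le.
Qed.

End bounded_density.

(** * Differentiability of convex functions *)

Section convex_slopes.
Context {R : realType} {d : nat}.
Implicit Types (phi : 'rV[R]_d -> \bar R) (x u : 'rV[R]_d) (a b c s t : R).
Local Open Scope ereal_scope.

Lemma convex_chord phi x u a b s t : econvex phi ->
  phi x = a%:E -> (0 < s <= t)%R -> phi (x + t *: u)%R <= b%:E ->
  phi (x + s *: u)%R <= (a + s / t * (b - a))%:E.
Proof.
move=> cphi xa /andP[s0]; rewrite le_eqVlt => /orP[/eqP <-|st] tb.
  by rewrite divff ?gt_eqF// mul1r addrCA subrr addr0.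
have t0 := lt_trans s0 st.
have tau : (0 < s / t < 1)%R by rewrite divr_gt0//= ltr_pdivrMr// mul1r.
have -> : (x + s *: u = (s / t) *: (x + t *: u) + (1 - s / t) *: x)%R.
  by apply/rowP => k; rewrite !mxE; field; rewrite gt_eqF.
apply: (le_trans (cphi _ _ _ tau)); rewrite xa.
apply: (@le_trans _ _ ((s / t)%:E * b%:E + (1 - s / t)%:E * a%:E)).
  by rewrite leeD2r// lee_wpmul2l// lee_fin ltW//; case/andP: tau.
by rewrite -!EFinM -EFinD lee_fin le_eqVlt; apply/orP; left; apply/eqP; ring.
Qed.

Lemma convex_slope_le phi x u a b c s t : econvex phi ->
  phi x = a%:E -> (0 < s)%R -> (0 < t)%R ->
  phi (x + t *: u)%R <= b%:E -> phi (x - s *: u)%R <= c%:E ->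
  ((a - c) / s <= (b - a) / t)%R.
Proof.
move=> cphi xa s0 t0 tb sc.
have st0 : (0 < s + t)%R by rewrite addr_gt0.
have tau : (0 < s / (s + t) < 1)%R.
  by rewrite divr_gt0//= ltr_pdivrMr// mul1r ltrDl.
have E : (x = (s / (s + t)) *: (x + t *: u) + (1 - s / (s + t)) *: (x - s *: u))%R.
  by apply/rowP => k; rewrite !mxE; field; rewrite gt_eqF.
have := cphi (x + t *: u)%R (x - s *: u)%R _ tau; rewrite -E xa => h.
have {h} : a%:E <= (s / (s + t))%:E * b%:E + (1 - s / (s + t))%:E * c%:E.
  apply: (le_trans h); case/andP: tau => ? ?.
  by apply: leeD; rewrite lee_wpmul2l// lee_fin ?subr_ge0 ltW.
rewrite -!EFinM -EFinD lee_fin => h.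
rewrite ler_pdivrMr// mulrAC ler_pdivlMr//.
have : (a * (s + t) <= s * b + t * c)%R.
  have -> : (s * b + t * c = (s / (s + t) * b + (1 - s / (s + t)) * c) * (s + t))%R.
    by field; rewrite gt_eqF.
  by rewrite ler_wpM2r// ltW.
nra.
Qed.

(** Points of the domain from which the domain cannot be continued in
    direction u. *)
Definition exit_set phi u := [set x | phi x < +oo /\
  forall j : nat, phi (x + j.+1%:R^-1 *: u)%R = +oo].

(** Points where t |-> phi (x + t u) - q t has a strict minimum at 0; tested
    on a sequence of steps only, which makes the set measurable. *)
Definition kink_set phi u (q : R) := [set x | phi x < +oo /\
  forall j : nat, phi x + (q / j.+1%:R)%:E < phi (x + j.+1%:R^-1 *: u)%R /\
    phi x - (q / j.+1%:R)%:E < phi (x - j.+1%:R^-1 *: u)%R].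

Section direction.
Variables (phi : 'rV[R]_d -> \bar R) (u : 'rV[R]_d).
Hypotheses (cphi : econvex phi) (phi_gtNy : forall x, -oo < phi x).

Lemma small_inv t : (0 < t)%R -> exists j : nat, (j.+1%:R^-1 <= t)%R.
Proof.
by move=> t0; have [j] := ltr_add_invr t0; rewrite add0r => /ltW; exists j.
Qed.

Lemma phi_real x : phi x < +oo -> exists a, phi x = a%:E.
Proof. by move=> xoo; exists (fine (phi x)); rewrite fineK// fin_real// phi_gtNy. Qed.

(** By convexity the domain contains the segment joining two of its points. *)
Lemma exit_set_shift x t : exit_set phi u x -> (0 < t)%R -> ~ exit_set phi u (x + t *: u)%R.
Proof.
move=> [xoo exitx] t0 [yoo _].
have [j jt] := small_inv t0.
have [a xE] := phi_real xoo; have [b yE] := phi_real yoo.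
have := convex_chord (s := j.+1%:R^-1%R) (t := t) (b := b) cphi xE.
by rewrite invr_gt0 ltr0n/= -yE => /(_ u jt (lexx _)); rewrite exitx.
Qed.

(** Otherwise s |-> phi (x + s u) - q s, which is convex, would grow from each end
    of [0, t] towards the interior. *)
Lemma kink_set_shift q x t : kink_set phi u q x -> (0 < t)%R ->
  ~ kink_set phi u q (x + t *: u)%R.
Proof.
move=> [xoo kx] t0 [yoo ky].
have [j jt] := small_inv t0.
have j0 : (0 < j.+1%:R^-1 :> R)%R by rewrite invr_gt0.
set y := (x + t *: u)%R in yoo ky *.
have [a xE] := phi_real xoo; have [b yE] := phi_real yoo.
have yx : (y + t *: (- u) = x)%R by rewrite scalerN addrK.
have jt' : (0 < (j.+1%:R^-1 : R) <= t)%R by apply/andP.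
have hx := convex_chord cphi xE jt' (_ : phi (x + t *: u)%R <= b%:E).
have hy := convex_chord cphi yE jt' (_ : phi (y + t *: - u)%R <= a%:E).
have [kx1 _] := kx j; have [_ ky2] := ky j.
rewrite !scalerN in hy yx.
have := lt_le_trans ky2 (hy _); rewrite yx xE => /(_ (lexx _)).
have := lt_le_trans kx1 (hx _); rewrite -/y yE => /(_ (lexx _)).
rewrite xE -EFinB -EFinD !lte_fin !ltrD2l => h1 h2.
by have := ltrD h1 h2; rewrite subrr -mulrDr addrA subrK subrr mulr0 ltxx.
Qed.

(** Away from these sets, the supremum of the slopes on the left and the
    infimum of those on the right cannot be separated by a rational. *)
Lemma directional_derivative x : phi x < +oo ->
  ~ exit_set phi u x -> ~ exit_set phi (- u)%R x ->
  (forall q : rat, ~ kink_set phi u (ratr q) x) ->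
  exists l : R, forall e, (0 < e)%R -> exists2 r : R, (0 < r)%R &
    forall t, (0 <= t <= r)%R ->
      phi (x + t *: u)%R <= phi x + (t * l + t * e)%:E /\
      phi (x - t *: u)%R <= phi x + (- (t * l) + t * e)%:E.
Proof.
move=> xoo nexit nexit' nkink.
have [a xE] := phi_real xoo.
pose SR : set R := [set s | exists2 t, (0 < t)%R & phi (x + t *: u)%R <= (a + t * s)%:E].
pose SL : set R := [set s | exists2 t, (0 < t)%R & phi (x - t *: u)%R <= (a - t * s)%:E].
have slope (w : 'rV[R]_d) : ~ exit_set phi w x ->
    exists t s, (0 < t)%R /\ phi (x + t *: w)%R <= (a + t * s)%:E.
  move=> nw; have [j jw] : exists j : nat, phi (x + j.+1%:R^-1 *: w)%R < +oo.
    apply: contrapT => /forallNP nj; apply: nw; split => // j.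
    by have /negP := nj j; rewrite -leNgt leye_eq => /eqP.
  exists (j.+1%:R^-1)%R, (j.+1%:R * (fine (phi (x + j.+1%:R^-1 *: w)%R) - a))%R.
  split; first by rewrite invr_gt0.
  by rewrite mulKf// addrCA subrr addr0 fineK// fin_real// phi_gtNy.
have le_LR s s' : SL s -> SR s' -> (s <= s')%R.
  move=> [t t0 st] [t' t'0 st'].
  have := convex_slope_le cphi xE t0 t'0 st' st.
  by rewrite opprB addrCA subrr addr0 addrAC subrr add0r !(mulrC t) (mulrC t') !mulfK ?gt_eqF.
have SR0 : SR !=set0.
  by have [t [s [t0 ts]]] := slope _ nexit; exists s; exists t.
have SL0 : SL !=set0.
  have [t [s [t0 ts]]] := slope _ nexit'; exists (- s)%R; exists t => //.
  by rewrite mulrN opprK -scalerN.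
have lbSR : has_inf SR.
  by split => //; have [s Ls] := SL0; exists s => s' Rs'; exact: le_LR.
have ubSL : has_sup SL.
  by split => //; have [s Rs] := SR0; exists s => s' Ls'; exact: le_LR.
have LR : sup SL = inf SR.
  apply/eqP; rewrite eq_le; apply/andP; split.
    by apply: ge_sup => // s Ls; apply: lb_le_inf => // s' Rs'; exact: le_LR.
  rewrite leNgt; apply/negP => /rat_in_itvoo[q]; rewrite in_itv/= => /andP[Lq qR].
  apply: (nkink q); split => // j; have j0 : (0 < j.+1%:R^-1 :> R)%R by rewrite invr_gt0.
  split; rewrite ltNge; apply/negP => le_q.
    move: qR; rewrite ltNge => /negP; apply; apply: ge_inf; first by case: lbSR.
    by exists (j.+1%:R^-1)%R => //; rewrite mulrC EFinD -xE.
  move: Lq; rewrite ltNge => /negP; apply; apply: ub_le_sup; first by case: ubSL.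
  by exists (j.+1%:R^-1)%R => //; rewrite mulrC EFinB -xE.
exists (inf SR) => e e0.
have [s [t1 t10 Rs] sl] := inf_adherent e0 lbSR.
have [s' [t2 t20 Ls'] ls] := sup_adherent e0 ubSL.
exists (Num.min t1 t2); first by rewrite lt_min t10.
move=> t /andP[]; rewrite le_eqVlt => /orP[/eqP <- _|t0].
  by rewrite scale0r subr0 addr0 !mul0r oppr0 addr0 adde0.
rewrite le_min => /andP[tt1 tt2]; split.
  apply: le_trans (convex_chord cphi xE _ Rs) _; first by rewrite t0.
  rewrite xE -EFinD lee_fin addrAC subrr add0r mulrA divfK ?gt_eqF// -mulrDr.
  by rewrite lerD2l ler_wpM2l// ltW.
have Ls2 : phi (x + t2 *: (- u))%R <= (a - t2 * s')%:E by rewrite scalerN.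
rewrite -(scalerN t u); apply: le_trans (convex_chord cphi xE _ Ls2) _.
  by rewrite t0.
rewrite xE -EFinD lee_fin addrAC subrr add0r.
rewrite mulrN mulrA divfK ?gt_eqF// -mulrN -mulrN -mulrDr lerD2l ler_wpM2l ?ltW//.
by move: ls; rewrite LR => ls; clear -ls; lra.
Qed.

End direction.

HB.instance Definition _ (v : 'rV[R]_d) := GRing.isLinear.Build R 'rV[R]_d R _
  (dotv v) (fun a y z => etrans (dotvDr _ _ v) (congr1 (+%R^~ _) (dotvZr a y v))).

Definition partial_derivatives phi x (v : 'rV[R]_d) :=
  forall i e, (0 < e)%R -> exists2 r : R, (0 < r)%R & forall t, (0 <= t <= r)%R ->
    phi (x + t *: delta_mx 0 i)%R <= phi x + (t * v ord0 i + t * e)%:E /\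
    phi (x - t *: delta_mx 0 i)%R <= phi x + (- (t * v ord0 i) + t * e)%:E.

(** Upper half of the differentiability of a convex function with partial
    derivatives. If c is the i-th coordinate of k and p the rest of k, then x + k
    is the midpoint of x + 2 p and x + 2 c e_i, which allows an induction on the
    number of nonzero coordinates. *)
Lemma convex_remainder phi x a (v : 'rV[R]_d) : econvex phi -> phi x = a%:E ->
  partial_derivatives phi x v ->
  forall e, (0 < e)%R -> exists2 r, (0 < r)%R & forall k : 'rV[R]_d,
    (`|k| <= r)%R -> phi (x + k)%R <= (a + dotv v k + e * `|k|)%:E.
Proof.
move=> cphi xE slopes.
pose small (e : R) (k : 'rV[R]_d) := phi (x + k)%R <= (a + dotv v k + e * `|k|)%:E.
have coord i (k : 'rV[R]_d) : (`|k ord0 i| <= `|k|)%R.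
  have -> : `|k|%R = mx_norm k by [].
  by rewrite mx_normrE; exact: (le_bigmax _ _ (ord0, i)).
have small_partial j : forall e, (0 < e)%R -> exists2 r, (0 < r)%R &
    forall k : 'rV[R]_d, (forall i : 'I_d, (j <= i)%N -> k ord0 i = 0%R) ->
      (`|k| <= r)%R -> small e k.
  elim: j => [|j IH] e e0.
    exists 1%R => // k k0 _; have -> : k = 0%R by apply/rowP => i; rewrite k0 ?mxE.
    by rewrite /small addr0 dotv0 normr0 mulr0 !addr0 xE.
  have [jd|dj] := ltnP j d; last first.
    have [r r0 hr] := IH e e0; exists r => // k k0; apply: hr => i ji.
    by have := ltn_ord i; rewrite ltnNge (leq_trans dj ji).
  have e20 : (0 < e / 2)%R by rewrite divr_gt0.
  have [r r0 hr] := IH _ e20; have [s s0 hs] := slopes (Ordinal jd) _ e20.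
  exists (Num.min (r / 2) (s / 2))%R; first by rewrite lt_min !divr_gt0.
  move=> k k0; rewrite le_min !ler_pdivlMr// => /andP[kr ks].
  set i := Ordinal jd; set c := k ord0 i; pose p := (k - c *: delta_mx 0 i)%R.
  have pk l : p ord0 l = if l == i then 0%R else k ord0 l.
    rewrite !mxE eqxx/=; case: eqVneq => [->|_]; first by rewrite mulr1 subrr.
    by rewrite mulr0 subr0.
  have np : (`|p| <= `|k|)%R.
    have -> : `|p|%R = mx_norm p by [].
    rewrite mx_normrE; apply: bigmax_le => [|[b l] _] //=; rewrite (ord1 b) pk.
    by case: ifP; rewrite ?normr0.
  have p2 : small (e / 2)%R (2 *: p)%R.
    apply: hr => [l jl|]; last by rewrite normrZ ger0_norm// mulrC (le_trans _ kr)// ler_wpM2r.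
    rewrite mxE pk; case: eqVneq => [_|li]; first by rewrite mulr0.
    by rewrite k0 ?mulr0// ltn_neqAle jl andbT; apply: contra li => /eqP jl'; apply/eqP/val_inj.
  have c2 : phi (x + 2 *: (c *: delta_mx 0 i))%R <=
      (a + dotv v (2 *: (c *: delta_mx 0 i)) + e / 2 * (2 * `|k|))%:E.
    have ck : (`|c| <= `|k|)%R := coord i k.
    rewrite scalerA dotvZr dotv_delta.
    have c2s : (0 <= `|2 * c| <= s)%R.
      by rewrite normr_ge0/= normrM ger0_norm// mulrC (le_trans _ ks)// ler_wpM2r.
    have [h1 h2] := hs _ c2s.
    have ek : (e / 2 * `|2 * c| <= e / 2 * (2 * `|k|))%R.
      by rewrite ler_pM2l// normrM ger0_norm// ler_pM2l.
    have [c0|c0] := leP 0%R (2 * c)%R.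
      rewrite ger0_norm// in h1 ek; apply: (le_trans h1).
      by rewrite xE -EFinD lee_fin -addrA lerD2l lerD2l mulrC.
    rewrite ltr0_norm// scaleNr opprK mulNr opprK in h2 ek; apply: (le_trans h2).
    by rewrite xE -EFinD lee_fin -addrA lerD2l lerD2l mulrC.
  have half : (0 < (2^-1 : R) < 1)%R by rewrite invr_gt0 ltr0n invf_lt1 ?ltr1n.
  have kE : (x + k = 2^-1 *: (x + 2 *: p) +
      (1 - 2^-1) *: (x + 2 *: (c *: delta_mx 0 i)))%R.
    by apply/rowP => l; rewrite !mxE; field.
  rewrite /small kE; apply: (le_trans (cphi _ _ _ half)).
  apply: (le_trans (leeD (lee_wpmul2l _ p2) (lee_wpmul2l _ c2))).
  - by rewrite lee_fin invr_ge0.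
  - by rewrite lee_fin subr_ge0 invf_le1// ler1n.
  rewrite -!EFinM -EFinD lee_fin.
  have vk : (dotv v k = dotv v p + dotv v (c *: delta_mx 0 i))%R.
    by rewrite -dotvDr subrK.
  rewrite vk !dotvZr normrZ (ger0_norm (ler0n _ 2)).
  have := ler_wpM2l (ltW e20) np; set w := dotv v (delta_mx 0%R i).
  by move: (dotv v p) w => P w' pk'; clear -pk'; lra.
move=> e /(small_partial d)[r r0 hr]; exists r => // k; apply: hr => i.
by rewrite leqNgt ltn_ord.
Qed.

(** Convexity turns an upper bound on the remainder at - k into a lower bound
    at k. *)
Lemma convex_is_gradient phi x (v : 'rV[R]_d) : econvex phi ->
  (forall y, -oo < phi y) -> phi x < +oo -> partial_derivatives phi x v ->
  is_gradient phi x v.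
Proof.
move=> cphi phi_gtNy xoo slopes.
have [a xE] : exists a, phi x = a%:E.
  by exists (fine (phi x)); rewrite fineK// fin_real// phi_gtNy.
have smallE := convex_remainder cphi xE slopes.
have both e : (0 < e)%R -> exists2 r, (0 < r)%R & forall k : 'rV[R]_d, (`|k| <= r)%R ->
    phi (x + k)%R \is a fin_num /\
    (`|fine (phi (x + k)%R) - a - dotv v k| <= e * `|k|)%R.
  move=> /smallE[r r0 hr]; exists r => // k kr.
  have kfin y : (`|y| <= r)%R -> phi (x + y)%R \is a fin_num.
    by move=> /hr yr; rewrite fin_real// phi_gtNy (le_lt_trans yr)// ltry.
  have kr' : (`|- k| <= r)%R by rewrite normrN.
  split; first exact: kfin.
  have := hr _ kr'; have := hr _ kr; rewrite normrN dotvNr.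
  rewrite -(fineK (kfin _ kr)) -(fineK (kfin _ kr')) !lee_fin => h1 h2.
  have : ((a - fine (phi (x - k)%R)) / 1 <= (fine (phi (x + k)%R) - a) / 1)%R.
    apply: (@convex_slope_le phi x k _ _ _ 1 1 cphi xE ltr01 ltr01);
    by rewrite scale1r fineK// kfin.
  rewrite !divr1 ler_norml => h3; clear -h1 h2 h3; apply/andP; split; lra.
have pfin : \forall y \near x, phi y \is a fin_num.
  have [r r0 hr] := both _ ltr01; apply/nbhs_ballP; exists r => // y.
  rewrite -ball_normE/= -normrN opprB => /ltW/hr[+ _].
  by rewrite addrCA subrr addr0.
pose df : {linear 'rV[R]_d -> R} := dotv v.
have cdf : continuous df.
  rewrite /df /= (_ : dotv v = fun y => dotv y v); first exact: continuous_dotvr.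
  by apply/funext => y; rewrite dotvC.
have [dE diffx] : 'd (fine \o phi) x = df :> (_ -> _) /\
    differentiable (fine \o phi) x.
  suff dphi (e : R) : (0 < e)%R -> \forall k \near (0 : 'rV[R]_d)%R,
      (`|fine (phi (k + x)%R) - (a + dotv v k)| <= e * `|k|)%R.
    have fE : fine (phi x) = a by rewrite xE.
    have dE : 'd (fine \o phi) x = df :> (_ -> _).
      by apply: diff_unique => //; apply/eqaddoP => e e0; rewrite /= fE; exact: dphi.
    split=> //; apply/diff_locallyP; rewrite dE; split => //.
    by apply/eqaddoP => e e0; rewrite /= fE; exact: dphi.
  move=> e0; have [r r0 hr] := both _ e0.
  apply/nbhs_ballP; exists r => // k; rewrite -ball_normE/= sub0r normrN.
  by move=> /ltW/hr[_]; rewrite opprD addrA (addrC k).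
by split=> // h; rewrite dE.
Qed.

Lemma convex_subgradient phi x a (v : 'rV[R]_d) : econvex phi ->
  (forall y, -oo < phi y) -> phi x = a%:E ->
  partial_derivatives phi x v -> forall y, (a + dotv v (y - x))%:E <= phi y.
Proof.
move=> cphi phi_gtNy xE slopes y.
case yE : (phi y) (phi_gtNy y) => [b| |] // _; last by rewrite leey.
have yb : phi (x + 1 *: (y - x))%R <= b%:E by rewrite scale1r addrC subrK yE.
rewrite lee_fin -lerBrDl; apply/ler_addgt0Pr => e e0.
set k := (y - x)%R in yb *.
have e'0 : (0 < e / (`|k| + 1))%R by rewrite divr_gt0// ltr_wpDl.
have [r r0 hr] := convex_remainder cphi xE slopes e'0.
set t := (r / (`|k| + 1))%R.
have t0 : (0 < t)%R by rewrite divr_gt0// ltr_wpDl.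
have k1 : (0 < `|k| + 1)%R by rewrite ltr_wpDl.
have tk : (`|- (t *: k)| <= r)%R.
  by rewrite normrN normrZ gtr0_norm// mulrAC ler_pdivrMr// ler_pM2l// lerDl.
have := convex_slope_le cphi xE t0 ltr01 yb (hr _ tk).
rewrite normrN normrZ (gtr0_norm t0) dotvNr dotvZr divr1.
have -> : ((a - (a - t * dotv v k + e / (`|k| + 1) * (t * `|k|))) / t =
    dotv v k - e * (`|k| / (`|k| + 1)))%R by field; rewrite !gt_eqF.
have : (e * (`|k| / (`|k| + 1)) <= e)%R.
  by rewrite ler_piMr ?ltW// ltr_pdivrMr// mul1r ltrDl.
by move: (dotv v k) (e * _)%R => p q h1 h2; clear -h1 h2; lra.
Qed.

Lemma is_gradientE phi x (v : 'rV[R]_d) : is_gradient phi x v -> gradient phi x = v.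
Proof.
move=> phiv; have [_ _ g] : is_gradient phi x (gradient phi x).
  by apply: (@xgetPex _ _ [set v | is_gradient phi x v]); exists v.
have [_ _ dv] := phiv; apply/rowP => i.
by rewrite -(dotv_delta i (gradient phi x)) -g dv dotv_delta.
Qed.

Lemma measurable_exit_set phi u : measurable_fun [set: 'rV[R]_d] phi ->
  measurable (exit_set phi u).
Proof.
move=> mphi.
rewrite (_ : exit_set phi u = [set x | phi x < +oo] `&`
    \bigcap_j [set x | +oo <= phi (x + j.+1%:R^-1 *: u)%R]).
  apply: measurableI.
    by rewrite -[X in measurable X]setTI; exact: emeasurable_fun_infty_o.
  apply: bigcap_measurable => // j _; rewrite -[X in measurable X]setTI.
  apply: emeasurable_fun_c_infty => //.
  exact: (measurableT_comp mphi (measurable_shift_rV _)).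
apply/seteqP; split => x [xoo h]; split=> // j.
  by move=> _ /=; rewrite h.
by have := h j I; rewrite /= leye_eq => /eqP.
Qed.

Lemma measurable_kink_set phi u q : measurable_fun [set: 'rV[R]_d] phi ->
  (forall y, -oo < phi y) -> measurable (kink_set phi u q).
Proof.
move=> mphi phi_gtNy.
have mD w (c : R) : measurable_fun [set: 'rV[R]_d]
    (fun x => phi (x + w)%R - (phi x + c%:E)).
  apply: emeasurable_funB.
    exact: (measurableT_comp mphi (measurable_shift_rV _)).
  by apply: emeasurable_funD => //; exact: measurable_cst.
pose D w c := [set x | 0 < phi (x + w)%R - (phi x + c%:E)].
have mDset w c : measurable (D w c).
  by rewrite -[X in measurable X]setTI; apply: emeasurable_fun_o_infty.
have -> : kink_set phi u q = [set x | phi x < +oo] `&`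
    \bigcap_j (D (j.+1%:R^-1 *: u) (q / j.+1%:R) `&`
               D (- (j.+1%:R^-1 *: u)) (- (q / j.+1%:R)))%R.
  have DE w c x : phi x < +oo -> D w c x = (phi x + c%:E < phi (x + w)%R).
    by move=> xoo; rewrite /D/= sube_gt0// fin_numD andbT fin_real// phi_gtNy.
  by apply/seteqP; split => x [xoo h]; split=> // j; [move=> _|];
    have := h j; rewrite /setI/= !DE// EFinN => -[].
apply: measurableI.
  by rewrite -[X in measurable X]setTI; exact: emeasurable_fun_infty_o.
by apply: bigcap_measurable => // j _; apply: measurableI.
Qed.

(** The exceptional points lie in countably many exit and kink sets along the
    axes; each of them is disjoint from its translates in one direction, hence
    null. *)
Lemma convex_gradient_ae phi : Gamma0 phi ->
  exists N : set 'rV[R]_d, [/\ measurable N, lebesgue_rV R d N = 0 &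
    forall x, phi x < +oo -> ~ N x -> partial_derivatives phi x (gradient phi x)].
Proof.
move=> [[phi_gtNy _] lphi cphi].
have mphi := lower_semicontinuous_measurable_rV lphi.
pose ei i : 'rV[R]_d := delta_mx 0%R i.
pose K i := \bigcup_(n : nat) (if @unpickle rat n is Some q
  then kink_set phi (ei i) (ratr q) else set0).
pose N := \big[setU/set0]_(i < d)
  (exit_set phi (ei i) `|` exit_set phi (- ei i)%R `|` K i).
have mK i (n : nat) : measurable (if @unpickle rat n is Some q
    then kink_set phi (ei i) (ratr q) else set0).
  by case: unpickle => // q; exact: measurable_kink_set.
have mN i : measurable (exit_set phi (ei i) `|` exit_set phi (- ei i)%R `|` K i).
  apply: measurableU; last exact: bigcupT_measurable.
  by apply: measurableU; exact: measurable_exit_set.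
have null A : measurable A -> lebesgue_rV R d A = 0 ->
    (lebesgue_rV R d).-negligible A by move=> mA A0; exact/negligibleP.
exists N; split.
- exact: bigsetU_measurable.
- apply/measure_negligible; first exact: bigsetU_measurable.
  rewrite /N; elim/big_ind : _ => [|A B|i _]; first exact: negligible_set0.
    exact: negligibleU.
  apply: negligibleU; first apply: negligibleU.
  + apply: null; first exact: measurable_exit_set.
    apply: (lebesgue_null_of_disjoint_shifts (v := ei i)).
      exact: measurable_exit_set.
    by move=> x t; exact: exit_set_shift.
  + apply: null; first exact: measurable_exit_set.
    apply: (lebesgue_null_of_disjoint_shifts (v := (- ei i)%R)).
      exact: measurable_exit_set.
    by move=> x t; exact: exit_set_shift.
  + apply: negligible_bigcup => n; case: unpickle => [q|]; last exact: negligible_set0.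
    apply: null; first exact: measurable_kink_set.
    apply: (lebesgue_null_of_disjoint_shifts (v := ei i)).
      exact: measurable_kink_set.
    by move=> x t; exact: kink_set_shift.
- move=> x xoo nNx.
  have nN i : ~ (exit_set phi (ei i) `|` exit_set phi (- ei i)%R `|` K i) x.
    by apply: contra_not nNx => h; rewrite /N (bigD1 i)//=; left.
  have dir i : exists l : R, forall e, (0 < e)%R -> exists2 r : R, (0 < r)%R &
      forall t, (0 <= t <= r)%R ->
      phi (x + t *: ei i)%R <= phi x + (t * l + t * e)%:E /\
      phi (x - t *: ei i)%R <= phi x + (- (t * l) + t * e)%:E.
    apply: directional_derivative => // [h|h|q h]; apply: (nN i).
    - by left; left.
    - by left; right.
    - by right; exists (pickle q); [exact: I|rewrite pickleK; exact: h].
  have [l hl] := choice dir.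
  suff -> : gradient phi x = \row_i l i.
    by move=> i e e0; have [s s0 hs] := hl i _ e0; exists s; rewrite ?mxE.
  apply: is_gradientE; apply: convex_is_gradient => // i e e0.
  by have [s s0 hs] := hl i _ e0; exists s; rewrite ?mxE.
Qed.

End convex_slopes.

(** * Integrals of functions that need not be measurable *)

Section monotone_integral.
Context {dT : measure_display} {T : measurableType dT} {R : realType}.
Variable mu : {measure set T -> \bar R}.
Implicit Types f g : T -> \bar R.
Local Open Scope ereal_scope.

(** The integral is a difference of suprema over simple functions below. *)
Lemma le_integral_pointwise f g : (forall x, f x <= g x) ->
  \int[mu]_x f x <= \int[mu]_x g x.
Proof.
move=> fg; rewrite /integral !patch_setT; apply: leeB; apply: ge_ereal_sup => /= _ [h hf <-];
  apply: ereal_sup_ubound; exists h => //= x; apply: (le_trans (hf x)).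
  by rewrite !funeposE ge_max !le_max fg lexx orbT.
by rewrite !funenegE ge_max !le_max leeN2 fg lexx orbT.
Qed.

(** Redefining g to be infinite on N does not change its integral. *)
Lemma le_integral_off_null f g (N : set T) : measurable N -> mu N = 0 ->
  measurable_fun setT g -> (forall x, ~ N x -> f x <= g x) ->
  \int[mu]_x f x <= \int[mu]_x g x.
Proof.
move=> mN N0 mg fg.
pose g' x := if x \in N then +oo else g x.
have mg' : measurable_fun setT g'.
  apply: measurable_fun_ifT => //; apply: (measurable_fun_bool true).
  rewrite (_ : _ @^-1` _ = N) ?setTI//.
  by apply/seteqP; split => x /=; rewrite -[_ = true]/(is_true _) in_setE.
have -> : \int[mu]_x g x = \int[mu]_x g' x.
  apply: ae_eq_integral => //.
  exists N; split => // x /=; apply: contra_notP => Nx _.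
  by rewrite /g' memNset.
apply: le_integral_pointwise => x; rewrite /g'; case: ifPn; first by rewrite leey.
by rewrite notin_setE; exact: fg.
Qed.

Section bounded_below.
Variables (f : T -> \bar R) (K : R) (N : set T).
Hypotheses (muoo : mu setT < +oo) (mN : measurable N) (N0 : mu N = 0).
Hypothesis Kf : forall x, ~ N x -> K%:E <= f x.

Lemma integral_funeneg_lty : \int[mu]_x f^\- x < +oo.
Proof.
apply: (@le_lt_trans _ _ (\int[mu]_x (`|K|)%:E)); last first.
  by rewrite integral_cst// lte_mul_pinfty// lee_fin.
apply: (le_integral_off_null mN N0) => // x Nx.
rewrite funenegE ge_max lee_fin normr_ge0 andbT leeNl.
by apply: le_trans (Kf Nx); rewrite lee_fin lerNl ler_normr lexx orbT.
Qed.

Lemma integral_gtNy : -oo < \int[mu]_x f x.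
Proof.
rewrite integralE ltNye adde_eq_ninfty negb_or; apply/andP; split.
  by rewrite gt_eqF// (lt_le_trans ltNy0)// integral_ge0.
by apply: contraTneq integral_funeneg_lty => /(congr1 oppe); rewrite oppeK => ->.
Qed.

Lemma integrable_bounded_below : measurable_fun setT f ->
  \int[mu]_x f x < +oo -> mu.-integrable setT f.
Proof.
move=> mf foo; have negoo := integral_funeneg_lty.
have posoo : \int[mu]_x f^\+ x < +oo.
  rewrite ltey; apply/eqP => fp; move: foo; rewrite integralE fp addye ?ltxx//.
  by apply: contraTneq negoo => /(congr1 oppe); rewrite oppeK => ->.
apply/integrableP; split => //.
under eq_integral do rewrite -/((abse \o f) _) fune_abse.
rewrite ge0_integralD//; first by rewrite lte_add_pinfty.
- exact: measurable_funepos.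
- exact: measurable_funeneg.
Qed.

End bounded_below.

Lemma limn_einf_ge (u : (\bar R)^nat) (c : \bar R) n0 :
  (forall n, (n0 <= n)%N -> c <= u n) -> c <= limn_einf u.
Proof.
move=> cu; rewrite limn_einf_lim; apply: lime_ge; first exact: is_cvg_einfs.
near=> n; apply: le_ereal_inf_tmp => _ [k /= nk <-]; apply: cu.
by apply: leq_trans nk; near: n; exists n0.
Unshelve. all: by end_near. Qed.

Lemma limn_einf_le (u : (\bar R)^nat) (c : \bar R) :
  (forall n, u n <= c) -> limn_einf u <= c.
Proof.
move=> uc; rewrite limn_einf_lim; apply: lime_le; first exact: is_cvg_einfs.
by apply: nearW => n; apply: le_trans (uc n); apply: ereal_inf_lbound; exists n => /=.
Qed.

End monotone_integral.

(** * Convex conjugates and optimal potentials *)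

Section conjugates.
Context {R : realType} {d : nat}.
Implicit Types (x y : 'rV[R]_d) (psi : 'rV[R]_d -> \bar R).
Local Open Scope ereal_scope.

Lemma conjugate_ge psi x y (a : R) : psi x <= a%:E ->
  (dotv x y - a)%:E <= conjugate psi y.
Proof.
move=> xa; apply: (@le_trans _ _ ((dotv x y)%:E - psi x)).
  by rewrite EFinB leeB.
by apply: ereal_sup_ubound; exists x.
Qed.

Lemma conjugate_le psi y c : (forall x, -oo < psi x) ->
  (forall x, (dotv x y)%:E <= c + psi x) -> conjugate psi y <= c.
Proof.
move=> psiNy h; apply: ge_ereal_sup => _ [x _ <-].
case psix : (psi x) (psiNy x) (h x) => [a| |] // _; last by rewrite addeNy leNye.
by rewrite leeBlDr.
Qed.

Lemma Gamma0_conjugate psi : (forall x, -oo < psi x) ->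
  (exists x, psi x < +oo) -> (exists y, conjugate psi y < +oo) ->
  Gamma0 (conjugate psi).
Proof.
move=> psiNy [x0 x0oo] domc; split; first split => //.
- move=> y; have [a ax] : exists a, psi x0 = a%:E.
    by exists (fine (psi x0)); rewrite fineK// fin_real// psiNy.
  by apply: lt_le_trans (conjugate_ge y (_ : psi x0 <= a%:E)); rewrite ?ax// ltNyr.
- move=> y a; rewrite /conjugate => /ereal_sup_gt[_ [x _ <-]].
  case psix : (psi x) (psiNy x) => [b| |] // _; rewrite -EFinB lte_fin => axy.
  exists [set z | (a + b < dotv z x)%R].
    apply: open_nbhs_nbhs; split; last by rewrite /= dotvC; move: axy; clear; lra.
    exact: (open_comp (fun z _ => @continuous_dotvr _ _ x z) (@open_gt _ (a + b))).
  move=> z /= abz; apply: lt_le_trans (conjugate_ge z (_ : psi x <= b%:E)).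
    by rewrite lte_fin dotvC; move: abz; clear; lra.
  by rewrite psix.
- move=> y z t /andP[t0 t1]; apply: ge_ereal_sup => _ [x _ <-].
  case psix : (psi x) (psiNy x) => [b| |] // _; last by rewrite addeNy leNye.
  have psixb : psi x <= b%:E by rewrite psix.
  have hy := conjugate_ge y psixb; have hz := conjugate_ge z psixb.
  apply: le_trans (leeD (lee_wpmul2l _ hy) (lee_wpmul2l _ hz)).
  + by rewrite -!EFinM -EFinD lee_fin dotvDr !dotvZr; move: (dotv x y) (dotv x z) => p q; clear; lra.
  + by rewrite lee_fin ltW.
  + by rewrite lee_fin subr_ge0 ltW.
Qed.

End conjugates.

Section optimality.
Context {R : realType} {d : nat} (mu nu : probability 'rV[R]_d R).
Context (phi : 'rV[R]_d -> \bar R) (phi_opt : optimal_brenier_potential mu nu phi).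
Implicit Types (x y : 'rV[R]_d) (F psi : 'rV[R]_d -> \bar R).
Local Open Scope ereal_scope.

(** The potential beats every pair of functions satisfying the dual
    constraint: replacing F by the conjugate of psi, and psi by the conjugate
    of that, only lowers the objective. *)
Lemma optimal_le_dual_pair F psi :
  (forall y, -oo < psi y) -> (exists y, psi y < +oo) -> (exists x, F x < +oo) ->
  (forall x y, (dotv y x)%:E <= F x + psi y) ->
  brenier_objective mu nu phi <= \int[mu]_x F x + \int[nu]_y psi y.
Proof.
move=> psiNy [y0 y0oo] [x0 x0oo] Fpsi.
have conjF x : conjugate psi x <= F x by exact: conjugate_le.
have G : Gamma0 (conjugate psi).
  by apply: Gamma0_conjugate => //; [exists y0|exists x0; exact: le_lt_trans (conjF x0) _].
apply: (le_trans (phi_opt.2 _ G)); apply: leeD.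
  exact: le_integral_pointwise.
apply: le_integral_pointwise => y.
have [[cNy _] _ _] := G.
apply: conjugate_le => // x.
case psiy : (psi y) (psiNy y) => [b| |] // _; last first.
  by rewrite addye ?leey// gt_eqF.
have := conjugate_ge x (_ : psi y <= b%:E); rewrite psiy lexx => /(_ isT).
by rewrite EFinB leeBlDr// addeC dotvC.
Qed.

End optimality.

Section potential_integrability.
Context {R : realType} {d : nat} (mu nu : probability 'rV[R]_d R) (r M : R).
Hypotheses (r_gt0 : (0 < r)%R).
Hypotheses (mu_ball : mu (~` eball r) = 0%E) (nu_ball : nu (~` eball r) = 0%E).
Hypothesis muM : has_density_bounded_by mu M.
Context (phi : 'rV[R]_d -> \bar R) (phi_opt : optimal_brenier_potential mu nu phi).
Implicit Types (x y : 'rV[R]_d).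
Local Open Scope ereal_scope.

Let phi_gtNy x : -oo < phi x.
Proof. by have [[[+ _] _ _] _] := phi_opt; apply. Qed.

Let mphi : measurable_fun setT phi.
Proof. by apply: lower_semicontinuous_measurable_rV; have [[]] := phi_opt. Qed.

Let mball : measurable (~` (eball r : set 'rV[R]_d)).
Proof. by apply: measurableC; exact: measurable_eball. Qed.

Lemma dotv_ball_le x y (s t : R) : (enorm x <= s)%R -> (enorm y <= t)%R -> (dotv x y <= s * t)%R.
Proof.
move=> xs yt; apply: (le_trans (cauchy_schwarz x y)).
by rewrite ler_pM ?enorm_ge0.
Qed.

(** The indicator of the ball, in the sense of convex analysis, and its conjugate
    r |y| are an admissible pair. *)
Lemma objective_lty : brenier_objective mu nu phi < +oo.
Proof.
pose F x : \bar R := if x \in eball r then 0 else +oo.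
apply: (@le_lt_trans _ _ (\int[mu]_x F x + \int[nu]_y (r * enorm y)%:E)).
  apply: (optimal_le_dual_pair phi_opt) => //.
  - by move=> y; rewrite ltNyr.
  - by exists 0%R; rewrite ltry.
  - by exists 0%R; rewrite /F mem_set /eball/= ?enorm0.
  - move=> x y; rewrite /F; case: ifPn => [|_]; last by rewrite addye ?leey.
    rewrite inE /eball/= add0e lee_fin mulrC => xr.
    by rewrite (dotv_ball_le (lexx _))// ltW.
apply: lte_add_pinfty.
  apply: (@le_lt_trans _ _ (\int[mu]_x (cst 0 x))); last by rewrite integral0.
  apply: (le_integral_off_null mball mu_ball) => // x.
  by rewrite /= not_notP => xr; rewrite /F mem_set.
apply: (@le_lt_trans _ _ (\int[nu]_x (cst (r * r)%:E x))); last first.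
  by rewrite integral_cst//= probability_setT mule1 ltry.
apply: (le_integral_off_null mball nu_ball) => // x.
by rewrite /= not_notP /eball/= => xr; rewrite lee_fin ler_pM2l// ltW.
Qed.

(** An affine minorant is given by a gradient when the domain is not
    mu-negligible, and otherwise by the finiteness of the objective. *)
Lemma conjugate_lty : exists y, conjugate phi y < +oo.
Proof.
have [G _] := phi_opt; have [_ _ cphi] := G.
have [N [mN N0 grad]] := convex_gradient_ae G.
have [[x [xN xoo]]|allN] := pselect (exists x, ~ N x /\ phi x < +oo).
  exists (gradient phi x); have [a xE] : exists a, phi x = a%:E.
    by exists (fine (phi x)); rewrite fineK// fin_real// phi_gtNy.
  have sub := convex_subgradient cphi phi_gtNy xE (grad x xoo xN).
  apply: le_lt_trans (ltry (dotv x (gradient phi x) - a)).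
  apply: conjugate_le => // y; apply: le_trans (leeD2l _ (sub y)).
  rewrite -EFinD lee_fin dotvBr !(dotvC (gradient _ _)) addrA subrK addrC subrK.
  exact: lexx.
apply: contrapT => /forallNP noy.
have noy' y : conjugate phi y = +oo.
  by have /negP := noy y; rewrite -leNgt leye_eq => /eqP.
have muN : mu N = 0 by exact: (bounded_density_null muM mN N0).
have phioo : \int[mu]_x phi x = +oo.
  rewrite (ae_eq_integral (cst +oo))//; first by rewrite integral_cst//= probability_setT mule1.
  exists N; split => // x /= xN; apply: contra_notP xN => xN _.
  by apply/eqP; rewrite -leye_eq leNgt; apply/negP => xoo; apply: allN; exists x.
have := objective_lty; rewrite /brenier_objective phioo.
rewrite (_ : conjugate phi = cst +oo); last by apply/funext.
by rewrite integral_cst//= probability_setT mule1.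
Qed.

(** Each of the two functions has an affine minorant given by a point of the
    domain of the other, so that neither integral is minus infinity and both are
    finite because their sum is. *)
Lemma potential_integrable :
  mu.-integrable setT phi /\ nu.-integrable setT (conjugate phi).
Proof.
have [G _] := phi_opt; have [[_ [x0 x0oo]] _ _] := G.
have [y0 y0oo] := conjugate_lty.
have [a x0a] : exists a, phi x0 = a%:E.
  by exists (fine (phi x0)); rewrite fineK// fin_real// phi_gtNy.
have cNy y : -oo < conjugate phi y.
  by apply: lt_le_trans (conjugate_ge y (_ : phi x0 <= a%:E)); rewrite ?x0a// ltNyr.
have [b y0b] : exists b, conjugate phi y0 = b%:E.
  by exists (fine (conjugate phi y0)); rewrite fineK// fin_real// cNy.
have mconj : measurable_fun setT (conjugate phi).
  apply: lower_semicontinuous_measurable_rV.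
  by have [] : Gamma0 (conjugate phi) by apply: Gamma0_conjugate => //;
    [exists x0|exists y0].
have low1 x : ~ (~` eball r) x -> (- (enorm y0 * r) - b)%:E <= phi x.
  rewrite /= not_notP /eball/= => xr.
  case xE : (phi x) (phi_gtNy x) => [c| |] // _; last by rewrite leey.
  have := conjugate_ge y0 (_ : phi x <= c%:E); rewrite xE lexx y0b => /(_ isT).
  rewrite !lee_fin => h.
  have := dotv_ball_le (_ : (enorm (- y0) <= enorm y0)%R) (ltW xr).
  rewrite enormN lexx => /(_ isT); rewrite dotvC dotvNr => hP.
  rewrite lerBlDr in h; rewrite lerBlDr addrC; apply: le_trans h.
  by rewrite lerNl.
have low2 y : ~ (~` eball r) y -> (- (enorm x0 * r) - a)%:E <= conjugate phi y.
  rewrite /= not_notP /eball/= => yr.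
  apply: le_trans (conjugate_ge y (_ : phi x0 <= a%:E)); last by rewrite x0a.
  rewrite lee_fin.
  have := dotv_ball_le (_ : (enorm (- x0) <= enorm x0)%R) (ltW yr).
  by rewrite enormN lexx => /(_ isT); rewrite dotvC dotvNr (dotvC y) lerD2r lerNl.
have mu1 : mu setT < +oo by rewrite probability_setT ltry.
have nu1 : nu setT < +oo by rewrite probability_setT ltry.
have g1 := integral_gtNy mu1 mball mu_ball low1.
have g2 := integral_gtNy nu1 mball nu_ball low2.
have Joo := objective_lty; rewrite /brenier_objective in Joo.
have h1 : \int[mu]_x phi x < +oo.
  by rewrite ltey; apply: contraTneq Joo => ->; rewrite addye ?gt_eqF// ltxx.
have h2 : \int[nu]_x conjugate phi x < +oo.
  by rewrite ltey; apply: contraTneq Joo => ->; rewrite addey ?gt_eqF// ltxx.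
split.
  exact: (integrable_bounded_below mu1 mball mu_ball low1).
exact: (integrable_bounded_below nu1 mball nu_ball low2).
Qed.

End potential_integrability.

(** * The duality gap controls Fenchel-Young deficiencies *)

Section interpolation_arithmetic.
Context {R : realFieldType}.

Lemma interpolation_constraint (t a c f g p q : R) : 0 < t < 1 ->
  p - a <= c -> q - f <= g ->
  (1 - t) * p + t * q <= (1 - t) * a + t * f + ((1 - t) * c + t * g).
Proof. by move=> /andP[t0 t1] h1 h2; nra. Qed.

(** The hypothesis is optimality of phi: p, c, f, g and P are the integrals of
    phi, its conjugate, F, chi and the competitor. *)
Lemma interpolation_gap (t p f P c g : R) : 0 < t ->
  p + c <= P + ((1 - t) * c + t * g) ->
  t^-1 * ((1 - t) * p + t * f - P) <= f + g - (p + c).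
Proof. by move=> t0 h; rewrite mulrC ler_pdivrMr//; nra. Qed.

(** P is the value of the competitor at x and a that of phi; f and fb are the
    values of F at x and x + h w, and l is the slope of phi in direction w. *)
Lemma interpolation_deficiency (t a h l f fb e P : R) : 0 < t ->
  P <= (1 - t) * (a + (- (t / (1 - t) * h * l) + t / (1 - t) * h * (e / h))) + t * fb ->
  0 < h -> t < 1 ->
  h * l + f - fb - e <= t^-1 * ((1 - t) * a + t * f - P).
Proof.
move=> t0 hP h0 t1; rewrite [leRHS]mulrC ler_pdivlMr//; move: hP.
have -> : (1 - t) * (a + (- (t / (1 - t) * h * l) + t / (1 - t) * h * (e / h))) + t * fb =
  (1 - t) * a - t * h * l + t * e + t * fb.
  by field; rewrite subr_eq0 !gt_eqF.
by move=> hP; nra.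
Qed.

Lemma inv_succ_ratio k : k.+2%:R^-1 / (1 - k.+2%:R^-1) = k.+1%:R^-1 :> R.
Proof.
have : 0 < k.+1%:R :> R by rewrite ltr0n.
rewrite -[k.+2]addn1 natrD; move: (k.+1%:R) => c c0.
by field; apply/andP; split; rewrite gt_eqF// ltr_wpDr.
Qed.

End interpolation_arithmetic.

Section duality_gap.
Context {R : realType} {d : nat} (mu nu : probability 'rV[R]_d R) (r M rho : R).
Hypotheses (mu_ball : mu (~` eball r) = 0%E) (r_rho : (r < rho)%R)
  (rho_gt0 : (0 < rho)%R).
Hypothesis muM : has_density_bounded_by mu M.
Context (phi : 'rV[R]_d -> \bar R) (phi_opt : optimal_brenier_potential mu nu phi).
Hypotheses (muphi : mu.-integrable setT phi) (nuphi : nu.-integrable setT (conjugate phi)).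
Context (F chi : 'rV[R]_d -> R).
Hypotheses (muF : mu.-integrable setT (EFin \o F)).
Hypotheses (nuchi : nu.-integrable setT (EFin \o chi)).
Hypothesis Fchi : forall b y, (enorm b < rho)%R -> (dotv b y - F b <= chi y)%R.
Implicit Types (x y : 'rV[R]_d).
Local Open Scope ereal_scope.

Let phi_gtNy x : -oo < phi x.
Proof. by have [[[+ _] _ _] _] := phi_opt; apply. Qed.

Let phi_real x : phi x < +oo -> exists a, phi x = a%:E.
Proof. by move=> xoo; exists (fine (phi x)); rewrite fineK// fin_real// phi_gtNy. Qed.

Let mball : measurable (~` (eball r : set 'rV[R]_d)).
Proof. by apply: measurableC; exact: measurable_eball. Qed.

Let dom_point : exists x a, phi x = a%:E.
Proof.
by have [[[_ [x /phi_real[a xa]]] _ _] _] := phi_opt; exists x, a.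
Qed.

Let conj_gtNy y : -oo < conjugate phi y.
Proof.
have [x0 [a x0a]] := dom_point.
by apply: lt_le_trans (conjugate_ge y (_ : phi x0 <= a%:E)); rewrite ?x0a// ltNyr.
Qed.

(** The competitor is the conjugate of a convex combination of the conjugate of
    the potential with chi. *)
Let mix (t : R) y := (1 - t)%:E * conjugate phi y + (t * chi y)%:E.

Let mix_gtNy t y : (0 < t < 1)%R -> -oo < mix t y.
Proof.
move=> /andP[t0 t1]; rewrite /mix; case: (conjugate phi y) (conj_gtNy y) => [b| |] // _.
  by rewrite ltNyr.
by rewrite gt0_muley ?lte_fin ?subr_gt0// addye.
Qed.

Let competitor_le t x b (a : R) : (0 < t < 1)%R -> phi x <= a%:E -> (enorm b < rho)%R ->
  conjugate (mix t) ((1 - t) *: x + t *: b)%R <= ((1 - t) * a + t * F b)%:E.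
Proof.
move=> t01 xa brho; have /andP[t0 t1] := t01.
apply: conjugate_le => y; first exact: mix_gtNy.
have := conjugate_ge y xa.
rewrite /mix; case: (conjugate phi y) (conj_gtNy y) => [c| |] // _; last first.
  by move=> _; rewrite gt0_muley ?lte_fin ?subr_gt0// addye// addey// leey.
rewrite lee_fin -EFinM -!EFinD lee_fin => xc.
rewrite dotvDr !dotvZr !(dotvC y); have := Fchi y brho => bc.
exact: interpolation_constraint.
Qed.

(** E x is the lower limit, as t = 1 / (k + 2) tends to 0, of
    ((1 - t) phi x + t F x - Phi x) / t, with Phi the competitor. It is
    nonnegative; optimality of phi against Phi bounds its integral by the gap.
    For the lower bound on E x, write x as (1 - t) z + t (x + h w) with
    z = x - (t / (1 - t)) h w: the competitor at x is at most
    (1 - t) phi z + t F (x + h w), and phi z is known to first order in t from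
    the gradient of phi at x. *)
Lemma duality_gap : exists (E : 'rV[R]_d -> \bar R) (N : set 'rV[R]_d),
  [/\ measurable_fun setT E, forall x, 0 <= E x, measurable N, mu N = 0 &
   \int[mu]_x E x <= \int[mu]_x (F x)%:E + \int[nu]_y (chi y)%:E -
                     brenier_objective mu nu phi] /\
  forall x, ~ N x -> [/\ (enorm x < r)%R, phi x < +oo &
    forall i (h : R), (0 < h)%R ->
    ((enorm (x + h *: delta_mx 0 i) < rho)%R ->
       (h * gradient phi x ord0 i + F x - F (x + h *: delta_mx 0 i))%:E <= E x) /\
    ((enorm (x - h *: delta_mx 0 i) < rho)%R ->
       (- (h * gradient phi x ord0 i) + F x - F (x - h *: delta_mx 0 i))%:E <= E x)].
Proof.
have [G _] := phi_opt.
have [N0 [mN0 lN0 grad]] := convex_gradient_ae G.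
have mphi : measurable_fun setT phi := measurable_int mu muphi.
pose D := eball r `&` [set x | phi x < +oo].
have mdom : measurable [set x | phi x < +oo].
  by rewrite -[X in measurable X]setTI; exact: emeasurable_fun_infty_o.
have mD : measurable D by apply: measurableI => //; exact: measurable_eball.
have D0 : mu (~` D) = 0.
  apply/measure_negligible; first exact: measurableC.
  rewrite /D setCI; apply: negligibleU; first exact/negligibleP.
  have [N [mN N0' sub]] := integrable_ae measurableT muphi.
  exists N; split => // x /= xoo; apply: sub => /(_ I); rewrite fin_numElt => /andP[_].
  by [].
pose t k : R := (k.+2%:R^-1)%R.
have t01 k : (0 < t k < 1)%R by rewrite invr_gt0 ltr0n/= invf_lt1 ?ltr1n ?ltr0n.
pose Phi k := conjugate (mix (t k)).
pose H k x := (1 - t k)%:E * phi x + (t k)%:E * (F x)%:E.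
have PhiH k x : D x -> Phi k x <= H k x.
  move=> [xr /phi_real[a xa]]; rewrite /H xa -!EFinM -EFinD.
  have -> : x = ((1 - t k) *: x + t k *: x)%R by rewrite -scalerDl subrK scale1r.
  rewrite -scalerDl subrK scale1r.
  have := @competitor_le (t k) x x a (t01 k).
  rewrite -scalerDl subrK scale1r; apply; first by rewrite xa.
  exact: lt_trans xr r_rho.
have [y0 [c0 y0c0]] : exists y0 c0, conjugate phi y0 = c0%:E.
  have [N [mN N0' sub]] := integrable_ae measurableT nuphi.
  apply: contrapT => /forallNP h.
  have : nu setT <= nu N.
    apply: le_measure; rewrite ?inE// => y _; apply: sub => /(_ I) yf.
    by apply: (h y); exists (fine (conjugate phi y)); rewrite fineK.
  by rewrite N0' probability_setT lee_fin ler10.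
have mixy0 k : mix (t k) y0 <= ((1 - t k) * c0 + t k * chi y0)%:E.
  by rewrite /mix y0c0.
have PhiNy k x : -oo < Phi k x.
  by apply: lt_le_trans (conjugate_ge x (mixy0 k)); rewrite ltNyr.
have Phi_low k x : ~ (~` eball r) x ->
    (- (enorm y0 * r) - ((1 - t k) * c0 + t k * chi y0))%:E <= Phi k x.
  rewrite /= not_notP /eball/= => xr; apply: le_trans (conjugate_ge x (mixy0 k)).
  rewrite lee_fin lerD2r lerNl.
  have := dotv_ball_le (_ : (enorm (- y0) <= enorm y0)%R) (ltW xr).
  by rewrite enormN lexx => /(_ isT); rewrite dotvC dotvNr dotvC.
have intH k : mu.-integrable setT (H k).
  by apply: integrableD => //; apply: integrableZl.
have domPhi k : exists x, Phi k x < +oo.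
  have [x0 [a x0a]] := dom_point; exists ((1 - t k) *: x0 + t k *: 0)%R.
  apply: le_lt_trans (competitor_le (t01 k) (_ : phi x0 <= a%:E) _) _.
  - by rewrite x0a.
  - by rewrite enorm0.
  - by rewrite ltry.
have mPhi k : measurable_fun setT (Phi k).
  apply: lower_semicontinuous_measurable_rV.
  have [] // : Gamma0 (Phi k); apply: Gamma0_conjugate => //.
  - by move=> y; exact: mix_gtNy.
  - by exists y0; apply: le_lt_trans (mixy0 k) _; rewrite ltry.
  - exact: domPhi.
have intPhi k : mu.-integrable setT (Phi k).
  apply: integrable_bounded_below (Phi_low k) _ _ => //.
    by rewrite /= probability_setT ltry.
  apply: (@le_lt_trans _ _ (\int[mu]_x H k x)); last first.
    exact: integrable_lty.
  apply: (le_integral_off_null (measurableC mD) D0); first exact: (measurable_int mu).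
  by move=> x; rewrite /= not_notP; exact: PhiH.
pose G' k x := (t k)^-1%:E * (H k x - Phi k x).
have t_gt0 k : (0 < t k)%R by case/andP: (t01 k).
have t_lt1 k : (t k < 1)%R by case/andP: (t01 k).
have intG k : mu.-integrable setT (G' k).
  by apply: integrableZl => //; exact: integrableB.
have mG k : measurable_fun D (G' k).
  by apply: measurable_funTS; exact: (measurable_int mu).
have G0 k x : D x -> 0 <= G' k x.
  move=> Dx; have := PhiH k x Dx; have [_ /phi_real[a xa]] := Dx; rewrite /G' /H xa.
  case: (Phi k x) (PhiNy k x) => [P| |] // _.
  rewrite -!EFinM -!EFinD -?EFinN -?EFinD -?EFinM !lee_fin => PH.
  by rewrite mulr_ge0 ?subr_ge0// invr_ge0 ltW.
pose E0 x := limn_einf (G' ^~ x).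
have mE0 : measurable_fun D E0.
  rewrite /E0 /limn_einf; apply: measurableT_comp => //.
  apply: measurable_fun_limn_esup => k; exact: measurableT_comp.
exists (E0 \_ D), (~` D `|` N0); split; first split.
- exact/(measurable_restrictT _ mD).
- move=> x; rewrite patchE; case: ifPn => //; rewrite inE => Dx.
  by apply: (limn_einf_ge (n0 := 0%N)) => k _; exact: G0.
- by apply: measurableU => //; exact: measurableC.
- apply/measure_negligible; first by apply: measurableU => //; exact: measurableC.
  apply: negligibleU; first by apply/negligibleP => //; exact: measurableC.
  by apply/negligibleP => //; exact: (bounded_density_null muM).
- rewrite -integral_mkcond; apply: (le_trans (fatou mu mD mG G0)).
  apply: limn_einf_le => k.
  have -> : \int[mu]_(x in D) G' k x = \int[mu]_x G' k x.
    rewrite [RHS](negligible_integral (measurableC mD))//.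
    by rewrite setDE setCK setTI.
  rewrite integralZl//; last exact: integrableB.
  rewrite integralB// integralD//; [|exact: integrableZl..].
  rewrite !integralZl//.
  have pair : brenier_objective mu nu phi <=
      \int[mu]_x Phi k x + \int[nu]_y mix (t k) y.
    apply: (optimal_le_dual_pair phi_opt).
    + by move=> y; exact: mix_gtNy.
    + by exists y0; apply: le_lt_trans (mixy0 k) _; rewrite ltry.
    + by have [x0 x0oo] := domPhi k; exists x0.
    + move=> x y; case mixy : (mix (t k) y) (mix_gtNy y (t01 k)) => [c| |] // _.
        have := conjugate_ge x (_ : mix (t k) y <= c%:E); rewrite mixy lexx => /(_ isT).
        by rewrite EFinB leeBlDr.
      by rewrite addey ?leey// gt_eqF.
  move: pair; rewrite /brenier_objective.
  have -> : \int[nu]_y mix (t k) y =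
      (1 - t k)%:E * \int[nu]_y conjugate phi y + (t k)%:E * \int[nu]_y (chi y)%:E.
    rewrite (_ : mix (t k) = fun y =>
        (1 - t k)%:E * conjugate phi y + (t k)%:E * (chi y)%:E).
      by rewrite integralD// ?integralZl//; exact: integrableZl.
    by apply/funext => y; rewrite /mix EFinM.
  have := integrable_fin_num measurableT muphi; have := integrable_fin_num measurableT nuphi.
  have := integrable_fin_num measurableT muF; have := integrable_fin_num measurableT nuchi.
  have := integrable_fin_num measurableT (intPhi k).
  move=> /fineK <- /fineK <- /fineK <- /fineK <- /fineK <-.
  rewrite -!EFinM -!EFinD -?EFinN -?EFinD -?EFinM !lee_fin.
  exact: interpolation_gap.
- move=> x nDN; have [xD xN] : D x /\ ~ N0 x.
    by split; [apply: contrapT => h; apply: nDN; left|move=> h; apply: nDN; right].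
  have [xr xoo] := xD; split=> //; have [a xa] := phi_real xoo.
  rewrite patchE mem_set// => i h h0.
  have slope := grad x xoo xN i.
  have dir (w : 'rV[R]_d) (l : R) : (forall e, (0 < e)%R -> exists2 s0, (0 < s0)%R &
      forall s, (0 <= s <= s0)%R -> phi (x - s *: w)%R <= phi x + (- (s * l) + s * e)%:E) ->
      (enorm (x + h *: w) < rho)%R ->
      (h * l + F x - F (x + h *: w))%:E <= E0 x.
    move=> wl xw; apply/lee_addgt0Pr => e e0.
    have [s0 s00 hs] := wl _ (divr_gt0 e0 h0).
    rewrite -leeBlDr// -EFinB.
    have [n0 n0s] := small_inv (divr_gt0 s00 h0).
    apply: (limn_einf_ge (n0 := n0)) => k kn0.
    have t1 := t_lt1 k; have t0 := t_gt0 k.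
    have tE : (t k / (1 - t k) = k.+1%:R^-1)%R by exact: inv_succ_ratio.
    have sh : (0 <= t k / (1 - t k) * h <= s0)%R.
      rewrite tE; apply/andP; split; first by rewrite mulr_ge0 ?invr_ge0 ?ltW.
      rewrite -ler_pdivlMr// (le_trans _ n0s)//.
      by rewrite lef_pV2 ?posrE// ler_nat.
    have := hs _ sh; rewrite xa -EFinD => pa.
    have := competitor_le (t01 k) pa xw.
    have -> : ((1 - t k) *: (x - (t k / (1 - t k) * h) *: w) + t k *: (x + h *: w) = x)%R.
      by apply/rowP => j; rewrite !mxE; field; rewrite subr_eq0 gt_eqF.
    rewrite -/(Phi k) /G' /H xa.
    case: (Phi k x) (PhiNy k x) => [P| |] // _.
    rewrite lee_fin => hP; rewrite -!EFinM -?EFinD -?EFinN -?EFinD -?EFinM lee_fin.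
    exact: interpolation_deficiency t0 hP h0 t1.
  split.
    by apply: dir => e /slope[s0 s00 hs]; exists s0 => // s /hs[].
  move=> xw; have := dir (- delta_mx 0%R i)%R (- gradient phi x ord0 i)%R.
  rewrite !scalerN mulrN; apply => // e /slope[s0 s00 hs]; exists s0 => // s /hs[+ _].
  by rewrite scalerN opprK mulrN opprK.
Qed.

End duality_gap.

(** * Empirical measures at a single scale *)

Section empirical_frequencies.
Context {dO : measure_display} {Omega : measurableType dO} {R : realType}.
Variable P : probability Omega R.
Local Open Scope ereal_scope.

Lemma integral_sum_indic (I : finType) (A : I -> set Omega) (c : R) : (0 <= c)%R ->
  (forall i, measurable (A i)) ->
  \int[P]_w (c * \sum_i \1_(A i) w)%:E = c%:E * \sum_i P (A i).
Proof.
move=> c0 mA.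
under eq_integral do rewrite EFinM -sumEFin.
rewrite ge0_integralZl//; last 2 first.
- apply: emeasurable_sum => i; exact/measurable_EFinP.
- by move=> w _; apply: sume_ge0 => i _; rewrite lee_fin.
rewrite ge0_integral_sum//; last first.
  by move=> i; exact/measurable_EFinP.
congr (_ * _); apply: eq_bigr => i _.
by rewrite integral_indic// setIT.
Qed.

(** Variance of an empirical frequency under pairwise independence; the square
    is expanded so that only integrals of nonnegative functions occur. *)
Lemma empirical_variance n (A : 'I_n -> set Omega) (p : R) : (0 < n)%N ->
  (forall i, measurable (A i)) -> (forall i, P (A i) = p%:E) ->
  (forall i j, i != j -> P (A i `&` A j) = (p * p)%:E) ->
  \int[P]_w ((p - n%:R^-1 * \sum_i \1_(A i) w) ^+ 2)%:E <= (p / n%:R)%:E.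
Proof.
move=> n0 mA PA PAA.
have n0' : (0 < n%:R :> R)%R by rewrite ltr0n.
have p0 : (0 <= p)%R by rewrite -lee_fin -(PA (Ordinal n0)).
have mind i : measurable_fun setT (\1_(A i) : Omega -> R) by exact: measurable_indic.
have mS : measurable_fun setT (fun w => \sum_i \1_(A i) w : R)%R.
  exact: measurable_sum.
set a := fun w => _.
have ma : measurable_fun setT a.
  apply/measurable_EFinP/measurable_funX/measurable_funB => //.
  exact: measurable_funM.
have a0 w : 0 <= a w by rewrite lee_fin sqr_ge0.
have E1 : \int[P]_w a w + (2 * p * n%:R^-1)%:E * \sum_i P (A i) =
   (p * p)%:E + (n%:R^-1 ^+ 2)%:E * \sum_(ij : 'I_n * 'I_n) P (A ij.1 `&` A ij.2).
  rewrite -integral_sum_indic//; last by rewrite !mulr_ge0// invr_ge0 ltW.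
  rewrite -ge0_integralD//; last 2 first.
  - by move=> w _; rewrite lee_fin mulr_ge0 ?sumr_ge0// !mulr_ge0// invr_ge0 ltW.
  - by apply/measurable_EFinP; exact: measurable_funM.
  rewrite -integral_sum_indic//; last by move=> ij; exact: measurableI.
  have -> : (p * p)%:E = \int[P]_w (cst (p * p)%:E w).
    by rewrite integral_cst//= probability_setT mule1.
  rewrite -ge0_integralD//; last 3 first.
  - by move=> w _; rewrite lee_fin mulr_ge0.
  - by move=> w _; rewrite lee_fin mulr_ge0 ?sumr_ge0.
  - apply/measurable_EFinP; apply: measurable_funM => //; apply: measurable_sum => ij.
    by apply: measurable_indic; exact: measurableI.
  apply: eq_integral => w _; rewrite /a -!EFinD; congr EFin.
  have -> : (\sum_(ij : 'I_n * 'I_n) \1_(A ij.1 `&` A ij.2) w =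
      (\sum_i \1_(A i) w) * (\sum_i \1_(A i) w) :> R)%R.
    rewrite mulr_suml -(pair_bigA _ (fun i j => \1_(A i `&` A j) w))/=.
    apply: eq_bigr => i _; rewrite mulr_sumr; apply: eq_bigr => j _.
    by rewrite indicI.
  by ring.
have S1 : \sum_i P (A i) = (n%:R * p)%:E.
  rewrite (eq_bigr (fun=> p%:E)) => [|i _]; last exact: PA.
  by rewrite sumEFin sumr_const card_ord mulr_natl.
have S2 : \sum_(ij : 'I_n * 'I_n) P (A ij.1 `&` A ij.2) <=
    (n%:R * p + (n%:R * n%:R) * (p * p))%:E.
  rewrite -(pair_bigA _ (fun i j => P (A i `&` A j)))/=.
  apply: (@le_trans _ _ (\sum_(i < n) (p + n%:R * (p * p))%:E)); last first.
    rewrite sumEFin sumr_const card_ord -mulr_natl lee_fin le_eqVlt; apply/orP; left.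
    by apply/eqP; ring.
  apply: lee_sum => i _; rewrite (bigD1 i)//= setIid PA EFinD leeD2l//.
  apply: (@le_trans _ _ (\sum_(j < n) (p * p)%:E)); last first.
    by rewrite sumEFin sumr_const card_ord lee_fin mulr_natl.
  rewrite [leRHS](bigD1 i)//= -[leLHS]add0e leeD ?lee_fin ?mulr_ge0//.
  by apply: lee_sum => j ji; rewrite PAA// eq_sym.
have afin : \int[P]_w a w \is a fin_num.
  rewrite ge0_fin_numE ?integral_ge0//.
  apply: (@le_lt_trans _ _ (\int[P]_w a w + (2 * p * n%:R^-1)%:E * \sum_i P (A i))).
    by rewrite leeDl// S1 -EFinM lee_fin !mulr_ge0// ?invr_ge0 ltW.
  rewrite E1; apply: (le_lt_trans (leeD2l _ (lee_wpmul2l _ S2))).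
    by rewrite lee_fin exprn_ge0// invr_ge0 ltW.
  by rewrite -EFinM -EFinD ltry.
have sq0 : 0 <= (n%:R^-1 ^+ 2 : R)%:E by rewrite lee_fin exprn_ge0// invr_ge0 ltW.
move: (leeD2l (p * p)%:E (lee_wpmul2l sq0 S2)).
rewrite -E1 S1 -(fineK afin) -!EFinM -!EFinD !lee_fin => h.
have E2 : (p * p + n%:R^-1 ^+ 2 * (n%:R * p + n%:R * n%:R * (p * p)) =
  p / n%:R + 2 * p * n%:R^-1 * (n%:R * p))%R by field; rewrite gt_eqF.
by move: h; rewrite E2 lerD2r.
Qed.

End empirical_frequencies.

Section grid.
Context {R : realType} {d : nat} (r : R) (k : nat).
Hypotheses (r_gt0 : 0 < r) (k_gt0 : (0 < k)%N).
Implicit Types (x : 'rV[R]_d) (c : {ffun 'I_d -> 'I_k}).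

Definition grid_step : R := 2 * r / k%:R.

Definition grid_point (j : nat) : R := - r + j%:R * grid_step.

(** Half-open cells, so that they partition the ball. *)
Definition grid_cell c : set 'rV[R]_d :=
  [set x | forall i, grid_point (c i) <= x ord0 i < grid_point (c i).+1].

Definition grid_corner c : 'rV[R]_d := \row_i grid_point (c i).

Lemma grid_step_gt0 : 0 < grid_step.
Proof. by rewrite divr_gt0 ?mulr_gt0// ltr0n. Qed.

Lemma measurable_grid_cell c : measurable (grid_cell c).
Proof.
rewrite (_ : grid_cell c = [set x | forall i,
    `[grid_point (c i), grid_point (c i).+1[%classic (x ord0 i)]).
  by apply: (measurable_box (fun=> measurable_itv _)).
by apply/seteqP; split => x xc i; have := xc i; rewrite /= in_itv.
Qed.

Lemma grid_cell_ball x : enorm x < r -> exists c0, forall c, grid_cell c x <-> c = c0.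
Proof.
move=> xr; have s0 := grid_step_gt0; have k0 : 0 < k%:R :> R by rewrite ltr0n.
have xi i : `|x ord0 i| < r := le_lt_trans (ler_coord_enorm x i) xr.
pose u i := (x ord0 i + r) / grid_step.
have u0 i : 0 <= u i.
  by have := xi i; rewrite ltr_norml => /andP[h _]; rewrite divr_ge0 ?ltW// -ltrBlDr sub0r.
have uk i : (Num.trunc (u i) < k)%N.
  have /andP[tr _] := truncn_itv (u0 i).
  rewrite -(ltr_nat R) (le_lt_trans tr)//.
  have -> : k%:R = (r + r) / grid_step by rewrite /grid_step; field; rewrite !gt_eqF.
  by rewrite ltr_pM2r ?invr_gt0// ltrD2r; have := xi i; rewrite ltr_norml => /andP[].
exists [ffun i => Ordinal (uk i)] => c.
have cell i (j : nat) : (grid_point j <= x ord0 i < grid_point j.+1) = (j%:R <= u i < j.+1%:R).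
  by rewrite /grid_point addrC lerBlDr (addrC (- r)) ltrBrDr ler_pdivlMr// ltr_pdivrMr.
split=> [xc|-> i].
  apply/ffunP => i; apply: val_inj; rewrite ffunE /=; apply/esym/eqP.
  by rewrite truncn_eq// -cell; exact: xc.
by rewrite cell ffunE /=; exact: truncn_itv.
Qed.

Lemma enorm_grid_corner c x : grid_cell c x -> enorm (x - grid_corner c) <= d%:R * grid_step.
Proof.
move=> xc; apply: (le_trans (ler_enorm_sum _)).
rewrite mulr_natl -[X in _ *+ X]card_ord -sumr_const; apply: ler_sum => i _.
have /andP[h1 h2] := xc i; rewrite !mxE ger0_norm ?subr_ge0//.
move: h2; rewrite /grid_point -natr1 mulrDl mul1r addrA => h2.
by rewrite lerBlDl ltW.
Qed.

Lemma enorm_grid_corner_le c : enorm (grid_corner c) <= d%:R * r.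
Proof.
apply: (le_trans (ler_enorm_sum _)).
rewrite mulr_natl -[X in _ *+ X]card_ord -sumr_const; apply: ler_sum => i _.
rewrite mxE /grid_point ler_norml lerDl mulr_ge0 ?(ltW grid_step_gt0)//=.
rewrite addrC lerBlDl -ler_pdivlMr ?grid_step_gt0//.
have k0 : 0 < k%:R :> R by rewrite ltr0n.
have -> : (r + r) / grid_step = k%:R by rewrite /grid_step; field; rewrite !gt_eqF.
by rewrite ler_nat ltnW.
Qed.

(** Replacing a Lipschitz function by its value at the corner of the cell costs
    one step; what remains only sees the masses of the cells. *)
Lemma lipschitz_integral_le (mu : probability 'rV[R]_d R) (F : 'rV[R]_d -> R) (L : R)
    n (x : 'I_n -> 'rV[R]_d) :
  mu (~` eball r) = 0%E -> 0 <= L -> (0 < n)%N -> (forall i, enorm (x i) < r) ->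
  (forall x y, F x - F y <= L * enorm (x - y)) ->
  (\int[mu]_x (F x)%:E <= (n%:R^-1 * \sum_i F (x i) + L * (2 * d%:R * grid_step +
    d%:R * r * \sum_c `|fine (mu (grid_cell c)) -
      n%:R^-1 * \sum_i \1_(grid_cell c) (x i)|))%:E)%E.
Proof.
move=> mu_ball L0 n0 xr FL; have n0' : 0 < n%:R :> R by rewrite ltr0n.
pose b c := F (grid_corner c) - F 0.
pose Ls := L * (d%:R * grid_step).
pose G x := \sum_c b c * \1_(grid_cell c) x.
have Gcell z : enorm z < r -> exists2 c, grid_cell c z & G z = b c.
  move=> /grid_cell_ball[c0 c0P]; exists c0; first exact/c0P.
  rewrite /G (bigD1 c0)//= big1 => [|c cc0].
    by rewrite indicE mem_set ?mulr1 ?addr0//; exact/c0P.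
  by rewrite indicE memNset ?mulr0// => /c0P/eqP; rewrite (negbTE cc0).
have FG z : enorm z < r -> F z <= F 0 + Ls + G z.
  move=> /Gcell[c zc ->]; have := FL z (grid_corner c).
  have := ler_wpM2l L0 (enorm_grid_corner zc); rewrite -/Ls /b; lra.
have GF z : enorm z < r -> F 0 + G z - Ls <= F z.
  move=> /Gcell[c zc ->]; have := FL (grid_corner c) z.
  rewrite -enormN opprB.
  have := ler_wpM2l L0 (enorm_grid_corner zc); rewrite -/Ls /b; lra.
have mc c : measurable (grid_cell c) := measurable_grid_cell c.
have mind c : measurable_fun setT (\1_(grid_cell c) : 'rV[R]_d -> R) by exact: measurable_indic.
have intE : (\int[mu]_x (F 0 + Ls + G x)%:E =
    (F 0 + Ls + \sum_c b c * fine (mu (grid_cell c)))%:E)%E.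
  have ib c : mu.-integrable setT (fun x => (b c)%:E * (\1_(grid_cell c) x)%:E)%E.
    by apply: integrableZl => //; exact: integrable_indic.
  transitivity (\int[mu]_x ((F 0 + Ls)%:E + \sum_c ((b c)%:E * (\1_(grid_cell c) x)%:E)))%E.
    by apply: eq_integral => z _; rewrite EFinD /G -sumEFin.
  rewrite integralD//; last 2 first.
  - by apply: finite_measure_integrable_cst.
  - by apply: (integrable_sum measurableT) => c _; exact: ib.
  rewrite integral_cst//= probability_setT mule1 integral_sum// [RHS]EFinD -sumEFin; congr (_ + _)%E.
  apply: eq_bigr => c _; rewrite integralZl ?integral_indic ?setIT//; last exact: integrable_indic.
  by rewrite EFinM fineK// fin_num_measure.
have step : (\int[mu]_x (F x)%:E <= \int[mu]_x (F 0 + Ls + G x)%:E)%E.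
  apply: (le_integral_off_null _ mu_ball).
  - by apply: measurableC; exact: measurable_eball.
  - apply/measurable_EFinP/measurable_funD => //; apply: measurable_sum => c.
    exact: measurable_funM.
  - by move=> z; rewrite /= not_notP /eball/= lee_fin; exact: FG.
apply: (le_trans step); rewrite intE lee_fin.
have avg : F 0 - Ls + n%:R^-1 * \sum_i G (x i) <= n%:R^-1 * \sum_i F (x i).
  have -> : F 0 - Ls + n%:R^-1 * \sum_i G (x i) = n%:R^-1 * \sum_i (F 0 + G (x i) - Ls).
    under [in RHS]eq_bigr do rewrite addrAC.
    rewrite big_split/= sumr_const card_ord -[(F 0 - Ls) *+ n]mulr_natl mulrDr.
    by rewrite mulrA mulVf ?gt_eqF// mul1r.
  by rewrite ler_pM2l ?invr_gt0//; apply: ler_sum => i _; exact: GF.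
have GE : n%:R^-1 * \sum_i G (x i) =
    \sum_c b c * (n%:R^-1 * \sum_i \1_(grid_cell c) (x i)).
  rewrite /G exchange_big/= mulr_sumr; apply: eq_bigr => c _.
  by rewrite -mulr_sumr mulrCA.
have diff : \sum_c b c * fine (mu (grid_cell c)) - n%:R^-1 * \sum_i G (x i) <=
   L * (d%:R * r * \sum_c `|fine (mu (grid_cell c)) - n%:R^-1 * \sum_i \1_(grid_cell c) (x i)|).
  rewrite GE -sumrB mulrA mulr_sumr; apply: ler_sum => c _.
  rewrite -mulrBr (le_trans (ler_norm _))// normrM ler_wpM2r//.
  have ec := ler_wpM2l L0 (enorm_grid_corner_le c).
  rewrite ler_norml /b; apply/andP; split.
    by rewrite lerNl opprB (le_trans (FL _ _))// sub0r enormN.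
  by rewrite (le_trans (FL _ _))// subr0.
move: avg diff; rewrite -/Ls !mulrDr.
have -> : L * (2 * d%:R * grid_step) = 2 * Ls by rewrite /Ls; ring.
by clear; lra.
Qed.

End grid.

Section law_of_large_numbers.
Context {R : realType} {d : nat} (r : R).
Hypothesis r_gt0 : (0 < r)%R.
Context {dO : measure_display} {Omega : measurableType dO} (P : probability Omega R).
Context {n : nat} (X : 'I_n -> {RV P >-> 'rV[R]_d}) (mu : probability 'rV[R]_d R).
Hypotheses (n_gt0 : (0 < n)%N) (X_iid : iid_sample X mu).
Hypothesis mu_ball : mu (~` eball r) = 0%E.
Local Open Scope ereal_scope.

Lemma measurable_sample (A : set 'rV[R]_d) i : measurable A -> measurable (X i @^-1` A).
Proof. by move=> mA; rewrite -[X in measurable X]setTI; exact: measurable_funP. Qed.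

Lemma sample_pairwise (A : set 'rV[R]_d) i j : measurable A -> i != j ->
  P (X i @^-1` A `&` X j @^-1` A) = mu A * mu A.
Proof.
move=> mA ij; have [indep same] := X_iid.
have := indep [set i; j]%SET (fun=> A) (fun=> mA).
rewrite big_setU1 ?inE//= big_set1 !same// => <-; congr (P _).
apply/seteqP; split => w /=.
  by move=> [Ai Aj] l /=; rewrite !inE => /orP[] /eqP ->.
by move=> h; split; apply: h; rewrite /= !inE eqxx ?orbT.
Qed.

(** Cells of side comparable to s number s^(-d), and the frequency of a cell of
    mass p fluctuates by (p / n)^(1/2); absolute values are bounded by squares
    with the inequality 2 |a| <= eta + a^2 / eta, for the same eta in every
    cell. *)
Lemma empirical_lipschitz_deviation (s : R) : (0 < s <= 1)%R -> (1 <= n%:R * s ^+ d.+2)%R ->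
  exists D : Omega -> R, [/\ measurable_fun setT D, forall w, (0 <= D w)%R,
    \int[P]_w (D w)%:E <= ((4 * d%:R * r + d%:R * r * 2 ^+ d) * s)%:E &
    forall w, (forall i, enorm (X i w) < r)%R ->
    forall (F : 'rV[R]_d -> R) (L : R), (0 <= L)%R ->
      (forall x y, F x - F y <= L * enorm (x - y))%R ->
      \int[mu]_x (F x)%:E <= (n%:R^-1 * \sum_i F (X i w) + L * D w)%:E].
Proof.
move=> /andP[s0 s1] ns.
pose k := (Num.trunc s^-1).+1.
have k0 : (0 < k)%N by [].
have k0' : (0 < k%:R :> R)%R by rewrite ltr0n.
have n0' : (0 < n%:R :> R)%R by rewrite ltr0n.
have sk : (s^-1 <= k%:R)%R by rewrite ltW// truncnS_gt.
have ks : (k%:R <= 2 / s)%R.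
  have s1' : (1 <= s^-1)%R by rewrite invf_ge1.
  have /andP[tr _] := truncn_itv (ltW (lt_le_trans ltr01 s1')).
  by rewrite /k -natr1 mulr_natl mulr2n lerD.
pose K : R := (k%:R ^+ d)%R; have K0 : (0 < K)%R by rewrite exprn_gt0.
have Ks : (K * s ^+ d <= 2 ^+ d)%R.
  have kss : (k%:R * s <= 2)%R by rewrite -ler_pdivlMr.
  by rewrite -exprMn; apply: lerXn2r => //; rewrite nnegrE// mulr_ge0// ltW.
(* there are K cells, and their contributions K eta and 1 / (n eta) balance *)
pose eta := (s / K)%R; have eta0 : (0 < eta)%R by rewrite divr_gt0.
pose p (c : {ffun 'I_d -> 'I_k}) := fine (mu (grid_cell r c)).
have pE c : mu (grid_cell r c) = (p c)%:E.
  by rewrite fineK// fin_num_measure//; exact: measurable_grid_cell.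
pose a c w : R := (p c - n%:R^-1 * \sum_i \1_(X i @^-1` grid_cell r c) w)%R.
pose q c w : R := (eta / 2 + (2 * eta)^-1 * a c w ^+ 2)%R.
have aq c w : (`|a c w| <= q c w)%R.
  rewrite /q -(real_normK (num_real (a c w))); move: (`|_|)%R => z.
  rewrite -subr_ge0 (_ : _ - _ = (2 * eta)^-1 * (z - eta) ^+ 2)%R.
    by rewrite mulr_ge0 ?sqr_ge0// invr_ge0 mulr_ge0// ltW.
  by field; rewrite gt_eqF.
have q0 c w : (0 <= q c w)%R := le_trans (normr_ge0 _) (aq c w).
have mcell (c : {ffun 'I_d -> 'I_k}) : measurable (grid_cell r c).
  exact: measurable_grid_cell.
have mX (c : {ffun 'I_d -> 'I_k}) i : measurable (X i @^-1` grid_cell r c).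
  exact: measurable_sample.
have ma c : measurable_fun setT (a c).
  apply: measurable_funB => //; apply: measurable_funM => //.
  by apply: measurable_sum => i; exact: measurable_indic.
have mq c : measurable_fun setT (q c).
  apply: measurable_funD => //; apply: measurable_funM => //.
  exact: measurable_funX.
pose D w := (2 * d%:R * grid_step r k + d%:R * r * \sum_c q c w)%R.
have dr0 : (0 <= d%:R * r)%R by rewrite mulr_ge0// ltW.
have gs0 : (0 <= grid_step r k)%R by rewrite ltW// grid_step_gt0.
exists D; split.
- by apply: measurable_funD => //; apply: measurable_funM => //; exact: measurable_sum.
- by move=> w; rewrite addr_ge0 ?mulr_ge0 ?sumr_ge0// ltW.
- have Eq c : \int[P]_w (q c w)%:E <= (eta / 2 + (2 * eta)^-1 * (p c / n%:R))%:E.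
    under eq_integral do rewrite EFinD.
    rewrite ge0_integralD//; last 3 first.
    + by move=> w _; rewrite lee_fin divr_ge0// ltW.
    + by move=> w _; rewrite lee_fin mulr_ge0 ?sqr_ge0// invr_ge0 mulr_ge0// ltW.
    + apply/measurable_EFinP; apply: measurable_funM => //; exact: measurable_funX.
    rewrite integral_cst//= probability_setT mule1 EFinD leeD2l//.
    under eq_integral do rewrite EFinM.
    rewrite ge0_integralZl//; last 3 first.
    + by apply/measurable_EFinP; exact: measurable_funX.
    + by move=> w _; rewrite lee_fin sqr_ge0.
    + by rewrite lee_fin invr_ge0 mulr_ge0// ltW.
    have eta2 : (0 <= (2 * eta)^-1)%R by rewrite invr_ge0 mulr_ge0// ltW.
    rewrite EFinM; apply: lee_wpmul2l; first by rewrite lee_fin.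
    apply: empirical_variance => // [i|i j ij].
      by have [_ ->] := X_iid; rewrite ?pE.
    by rewrite sample_pairwise// pE EFinM.
  under eq_integral do rewrite EFinD.
  rewrite ge0_integralD//; last 3 first.
  + by move=> w _; rewrite lee_fin; apply: mulr_ge0 => //; exact: mulr_ge0.
  + by move=> w _; rewrite lee_fin mulr_ge0// sumr_ge0.
  + by apply/measurable_EFinP; apply: measurable_funM => //; exact: measurable_sum.
  rewrite integral_cst//= probability_setT mule1.
  under eq_integral do rewrite EFinM -sumEFin.
  rewrite ge0_integralZl//; last 2 first.
  + by apply: emeasurable_sum => c; exact/measurable_EFinP.
  + by move=> w _; apply: sume_ge0 => c _; rewrite lee_fin.
  rewrite ge0_integral_sum//; last 2 first.
  + by move=> c; exact/measurable_EFinP.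
  + by move=> c w _; rewrite lee_fin.
  have sum_p : (\sum_c p c <= 1)%R.
    rewrite -lee_fin -sumEFin (eq_bigr (fun c => mu (grid_cell r c))) => [|c _]; last by rewrite pE.
    rewrite -[leLHS]mul1e -integral_sum_indic//.
    have -> : 1%:E = \int[mu]_x (cst 1%:E x) by rewrite integral_cst//= probability_setT mule1.
    apply: (le_integral_off_null _ mu_ball) => //; first by apply: measurableC; exact: measurable_eball.
    move=> x; rewrite /= not_notP /eball/= => /(grid_cell_ball r_gt0 k0)[c0 c0P].
    rewrite lee_fin mul1r (bigD1 c0)//= big1 => [|c cc0].
      by rewrite indicE mem_set ?addr0//; exact/c0P.
    by rewrite indicE memNset// => /c0P/eqP; rewrite (negbTE cc0).
  apply: (@le_trans _ _ ((2 * d%:R * grid_step r k)%:E + (d%:R * r)%:E *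
      (\sum_c (eta / 2 + (2 * eta)^-1 * (p c / n%:R))%R)%:E)).
    rewrite leeD2l// lee_wpmul2l ?lee_fin// -sumEFin.
    by apply: lee_sum => c _; exact: Eq.
  rewrite -EFinM -EFinD lee_fin big_split/= sumr_const card_ffun !card_ord -mulr_sumr -mulr_suml.
  have step_s : (grid_step r k <= 2 * r * s)%R.
    by rewrite /grid_step ler_pM2l ?mulr_gt0// -[leRHS]invrK lef_pV2 ?posrE ?invr_gt0.
  have fluct : ((\sum_c p c) / n%:R <= n%:R^-1)%R.
    by rewrite -[leRHS]mul1r ler_wpM2r// invr_ge0 ltW.
  have bound : (eta / 2 *+ k ^ d + (2 * eta)^-1 * ((\sum_c p c) / n%:R) <= 2 ^+ d * s)%R.
    have d1 : (1 <= 2 ^+ d :> R)%R by rewrite exprn_ege1// ler1n.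
    rewrite -mulr_natl natrX -/K.
    have -> : (K * (eta / 2) = s / 2)%R by rewrite /eta; field; rewrite gt_eqF.
    have h1 : ((2 * eta)^-1 * ((\sum_c p c) / n%:R) <= (2 * eta)^-1 * n%:R^-1)%R.
      by rewrite ler_wpM2l// invr_ge0 mulr_ge0// ltW.
    have h2 : ((2 * eta)^-1 * n%:R^-1 <= 2 ^+ d * s / 2)%R.
      have -> : ((2 * eta)^-1 * n%:R^-1 = K / (2 * (n%:R * s)))%R.
        by rewrite /eta; field; rewrite !gt_eqF.
      rewrite ler_pdivrMr ?mulr_gt0//.
      have -> : (2 ^+ d * s / 2 * (2 * (n%:R * s)) = 2 ^+ d * (n%:R * s ^+ 2))%R by field.
      have sd0 : (0 < s ^+ d)%R by rewrite exprn_gt0.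
      rewrite -(ler_pM2r sd0) (le_trans Ks)// -mulrA ler_peMr ?exprn_ge0//.
      by rewrite -mulrA -exprD.
    apply: (le_trans (lerD (lexx _) (le_trans h1 h2))).
    have : (s <= 2 ^+ d * s)%R by rewrite ler_peMl// ltW.
    set y := (2 ^+ d * s)%R => sy; rewrite -mulrDl ler_pdivrMr// mulr_natr mulr2n.
    by rewrite lerD2r.
  have h3 := ler_wpM2l dr0 bound.
  have h4 : (2 * d%:R * grid_step r k <= 2 * d%:R * (2 * r * s))%R by rewrite ler_wpM2l// mulr_ge0.
  apply: (le_trans (lerD h4 h3)); rewrite le_eqVlt; apply/orP; left; apply/eqP; ring.
- move=> w Xr F L L0 FL.
  apply: (le_trans (lipschitz_integral_le r_gt0 k0 mu_ball L0 n_gt0 Xr FL)).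
  rewrite lee_fin lerD2l ler_wpM2l// lerD2l ler_wpM2l// ler_sum// => c _.
  by apply: le_trans (aq c w); rewrite /a.
Qed.

End law_of_large_numbers.

(** * The discrete dual problem *)

Section discrete_dual.
Context {R : realType} {d n m : nat}.
Variables (x : 'I_n -> 'rV[R]_d) (y : 'I_m -> 'rV[R]_d) (r rho : R).
Hypotheses (m_gt0 : (0 < m)%N) (r_ge0 : 0 <= r) (rho_gt0 : 0 < rho).
Hypothesis y_ball : forall j, enorm (y j) < r.
Variables (f : 'I_n -> R) (g : 'I_m -> R).
Implicit Types z b : 'rV[R]_d.

Let piece z k := dotv z (y k) + g k - 2^-1 * enorm (y k) ^+ 2.

Lemma dual_potential_attained z : exists k,
  dual_potential y g z = (piece z k)%:E /\ forall l, piece z l <= piece z k.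
Proof.
have k0 : 'I_m by exact: Ordinal m_gt0.
have E := @bigmax_eq_arg _ _ _ (-oo%E : \bar R) k0 xpredT (fun k => (piece z k)%:E) isT
  (fun k _ => leNye _).
exists [arg max_(i > k0) (piece z i)%:E]%O; split; first exact: E.
move=> l; rewrite -lee_fin -E; exact: (le_bigmax _ (fun k => (piece z k)%:E)).
Qed.

Definition real_dual_potential z := fine (dual_potential y g z).

Let F := real_dual_potential.

Lemma real_dual_potentialE z : dual_potential y g z = (F z)%:E.
Proof. by rewrite /F /real_dual_potential; have [k [-> _]] := dual_potential_attained z. Qed.

Lemma real_dual_potential_attained z : exists k, F z = piece z k.
Proof.
have [k [zk _]] := dual_potential_attained z; exists k.
by apply: EFin_inj; rewrite -real_dual_potentialE.
Qed.

Lemma real_dual_potential_ge z k : piece z k <= F z.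
Proof.
have [l [zl h]] := dual_potential_attained z.
by have -> : F z = piece z l by apply: EFin_inj; rewrite -real_dual_potentialE.
Qed.

Lemma real_dual_potential_lipschitz z z' : F z - F z' <= r * enorm (z - z').
Proof.
have [k ->] := real_dual_potential_attained z.
have h1 := real_dual_potential_ge z' k.
have h2 : dotv (z - z') (y k) <= r * enorm (z - z').
  rewrite (le_trans (cauchy_schwarz _ _))// mulrC ler_wpM2r ?enorm_ge0//.
  by rewrite ltW.
move: h1 h2; rewrite /piece dotvBl; lra.
Qed.

(** The conjugate of the estimated potential restricted to a ball: it is finite
    and Lipschitz, whereas the conjugate itself is infinite outside the convex
    hull of the sample. *)
Definition local_conjugate (v : 'rV[R]_d) : R :=
  sup [set dotv b v - F b | b in eball rho].

Let chi := local_conjugate.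

Lemma local_conjugate_ge b v : enorm b < rho -> dotv b v - F b <= chi v.
Proof.
move=> brho; apply: ub_le_sup; last by exists b.
exists (rho * enorm v - F 0 + r * rho) => _ [c crho <-].
have h1 := cauchy_schwarz c v.
have h2 : enorm c * enorm v <= rho * enorm v by rewrite ler_wpM2r ?enorm_ge0// ltW.
have := real_dual_potential_lipschitz 0 c; rewrite sub0r enormN => h3.
have h4 : r * enorm c <= r * rho by rewrite ler_wpM2l// ltW.
by move: h1 h2 h3 h4; lra.
Qed.

Lemma local_conjugate_le v c : (forall b, enorm b < rho -> dotv b v - F b <= c) ->
  chi v <= c.
Proof.
move=> h; apply: ge_sup; last by move=> _ [b brho <-]; exact: h.
by exists (dotv 0 v - F 0); exists 0 => //; rewrite /eball/= enorm0.
Qed.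

Lemma local_conjugate_lipschitz v v' : chi v - chi v' <= rho * enorm (v - v').
Proof.
rewrite lerBlDl; apply: local_conjugate_le => b brho.
have h1 := local_conjugate_ge v' brho; have h2 := cauchy_schwarz b (v - v').
have h3 : enorm b * enorm (v - v') <= rho * enorm (v - v').
  by rewrite ler_wpM2r ?enorm_ge0// ltW.
by move: h1 h2 h3; rewrite dotvBr; lra.
Qed.

Lemma local_conjugate_sample j : chi (y j) <= 2^-1 * enorm (y j) ^+ 2 - g j.
Proof.
apply: local_conjugate_le => b _; have := real_dual_potential_ge b j.
by rewrite /piece; lra.
Qed.

Hypothesis fg_opt : dual_optimal (fun=> n%:R^-1) x (fun=> m%:R^-1) y f g.

Lemma dual_optimal_sample i : F (x i) <= 2^-1 * enorm (x i) ^+ 2 - f i.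
Proof.
have [k ->] := real_dual_potential_attained (x i).
have := fg_opt.1 i k; rewrite sqr_enormB /piece; lra.
Qed.

(** The dual solution (f, g) competes with the pair obtained from any alpha,
    beta satisfying the constraint in its Fenchel-Young form. *)
Lemma empirical_objective_le (alpha : 'I_n -> R) (beta : 'I_m -> R) :
  (forall i j, dotv (x i) (y j) <= alpha i + beta j) ->
  n%:R^-1 * \sum_i F (x i) + m%:R^-1 * \sum_j chi (y j) <=
  n%:R^-1 * \sum_i alpha i + m%:R^-1 * \sum_j beta j.
Proof.
move=> ab.
pose f' i := 2^-1 * enorm (x i) ^+ 2 - alpha i.
pose g' j := 2^-1 * enorm (y j) ^+ 2 - beta j.
have feas : dual_feasible x y f' g'.
  by move=> i j; rewrite sqr_enormB /f' /g'; have := ab i j; lra.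
have := fg_opt.2 _ _ feas; rewrite /dual_value -!mulr_suml !(mulrC _ _^-1).
have h1 : n%:R^-1 * \sum_i F (x i) <= n%:R^-1 * \sum_i (2^-1 * enorm (x i) ^+ 2 - f i).
  by rewrite ler_wpM2l ?invr_ge0//; apply: ler_sum => i _; exact: dual_optimal_sample.
have h2 : m%:R^-1 * \sum_j chi (y j) <= m%:R^-1 * \sum_j (2^-1 * enorm (y j) ^+ 2 - g j).
  by rewrite ler_wpM2l ?invr_ge0//; apply: ler_sum => j _; exact: local_conjugate_sample.
move: h1 h2; rewrite /f' /g' !sumrB !mulrBr; lra.
Qed.

Lemma subgradient_real (T : 'rV[R]_d -> 'rV[R]_d) :
  (forall z, subdifferential (dual_potential y g) z (T z)) ->
  forall z z', F z + dotv (T z) (z' - z) <= F z'.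
Proof. by move=> HT z z'; have := HT z z'; rewrite !real_dual_potentialE lee_fin. Qed.

End discrete_dual.

(** * Stability of gradients *)

Lemma abs_slope_le (R : realFieldType) (e Fp Fm Fx v z : R) :
  v + Fx - Fp <= e -> - v + Fx - Fm <= e -> Fx - z <= Fm -> Fx + z <= Fp ->
  - (e + (Fp + Fm - 2 * Fx)) <= v - z <= e + (Fp + Fm - 2 * Fx).
Proof. by lra. Qed.

Section gradient_stability.
Context {R : realType} {d : nat}.

Lemma lipschitz_integrable (mu : probability 'rV[R]_d R) (r L : R) (F : 'rV[R]_d -> R) :
  mu (~` eball r) = 0%E -> 0 <= L ->
  (forall x y, F x - F y <= L * enorm (x - y)) -> mu.-integrable setT (EFin \o F).
Proof.
move=> mu_ball L0 FL; apply/integrableP; split.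
  by apply/measurable_EFinP; exact: continuous_measurable_rV (lipschitz_enorm_continuous FL).
apply: (@le_lt_trans _ _ (\int[mu]_x (cst (`|F 0| + L * r)%:E x))%E); last first.
  by rewrite integral_cst//= probability_setT mule1 ltry.
apply: (le_integral_off_null _ mu_ball) => //; first by apply: measurableC; exact: measurable_eball.
move=> x; rewrite /= not_notP /eball/= => /ltW xr; rewrite lee_fin -lerBlDl.
apply: (le_trans (lerB_dist _ _)); apply: (@le_trans _ _ (L * enorm x)); last by rewrite ler_wpM2l.
rewrite ler_norml; apply/andP; split.
  by rewrite lerNl opprB (le_trans (FL _ _))// sub0r enormN.
by rewrite (le_trans (FL _ _))// subr0.
Qed.

Lemma subgradient_second_difference_ge0 (F : 'rV[R]_d -> R) (T : 'rV[R]_d -> 'rV[R]_d) :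
  (forall z z', F z + dotv (T z) (z' - z) <= F z') ->
  forall v x, 0 <= second_difference F v x.
Proof.
move=> FT v x; have h1 := FT x (x + v); have h2 := FT x (x - v).
move: h1 h2; rewrite /second_difference ![x + _ - x]addrC !addKr dotvNr; lra.
Qed.

Context (mu nu : probability 'rV[R]_d R) (r M : R).
Hypotheses (r_gt0 : (0 < r)%R) (M_gt0 : (0 < M)%R).
Hypotheses (mu_ball : mu (~` eball r) = 0%E) (nu_ball : nu (~` eball r) = 0%E).
Hypothesis muM : has_density_bounded_by mu M.
Context (phi : 'rV[R]_d -> \bar R) (phi_opt : optimal_brenier_potential mu nu phi).
Context (F chi : 'rV[R]_d -> R) (T : 'rV[R]_d -> 'rV[R]_d) (L : R).
Hypothesis FL : forall x y, F x - F y <= r * enorm (x - y).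
Hypothesis L_ge0 : 0 <= L.
Hypothesis chiL : forall x y, chi x - chi y <= L * enorm (x - y).
Hypothesis Fchi : forall b y, enorm b < r + 1 -> dotv b y - F b <= chi y.
Hypothesis FT : forall z z', F z + dotv (T z) (z' - z) <= F z'.

Let gap : \bar R :=
  (\int[mu]_x (F x)%:E + \int[nu]_y (chi y)%:E - brenier_objective mu nu phi)%E.

(** A coordinate of h (grad phi - T) is bounded by E plus a second difference of
    F: the lower bound on E at x + h e_i is added to the subgradient inequality
    at x - h e_i, or conversely. The density bound turns the mu-integral of the
    second difference into a Lebesgue integral. The radius r + 1 leaves room for
    steps h <= 1 from points of the ball. *)
Lemma gradient_stability (h : R) : 0 < h <= 1 ->
  (\int[mu]_x (enorm (gradient phi x - T x))%:E <=
   (h^-1 * d%:R)%:E * (gap + (M * (2 * r * (2 * r) ^+ d.-1 * h ^+ 2))%:E))%E.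
Proof.
move=> /andP[h0 h1].
have [muphi nuphi] := potential_integrable r_gt0 mu_ball nu_ball muM phi_opt.
have muF := lipschitz_integrable mu_ball (ltW r_gt0) FL.
have nuchi := lipschitz_integrable nu_ball L_ge0 chiL.
have r_rho : r < r + 1 by rewrite ltrDl.
have rho0 : 0 < r + 1 := lt_trans r_gt0 r_rho.
have [E [N [[mE E0 mN N0 EJ] EN]]] :=
  duality_gap mu_ball r_rho rho0 muM phi_opt muphi nuphi muF nuchi Fchi.
pose D (i : 'I_d) : 'rV[R]_d -> \bar R :=
  (EFin \o second_difference F (h *: delta_mx 0 i)) \_ (cube r).
have mF : measurable_fun setT F := continuous_measurable_rV (lipschitz_enorm_continuous FL).
have mdiff i : measurable_fun setT (EFin \o second_difference F (h *: delta_mx 0 i)).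
  apply/measurable_EFinP/measurable_funB; last by apply: measurable_funM.
  apply: measurable_funD; first exact: (measurableT_comp mF (measurable_shift_rV _)).
  exact: (measurableT_comp mF (measurable_shift_rV _)).
have diff0 i x : 0 <= second_difference F (h *: delta_mx 0 i) x.
  exact: subgradient_second_difference_ge0.
have mD i : measurable_fun setT (D i).
  apply/(measurable_restrictT _ (measurable_cube _)).
  exact: measurable_funTS.
have D0 i x : (0 <= D i x)%E by rewrite /D patchE; case: ifP => // _; rewrite lee_fin.
have ID i : (\int[mu]_x D i x <= (M * (2 * r * (2 * r) ^+ d.-1 * h ^+ 2))%:E)%E.
  rewrite /D -integral_mkcond.
  apply: (le_trans (bounded_density_integral_le M_gt0 muM (measurable_cube _) (mdiff i) _)).
    by move=> x; rewrite lee_fin.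
  rewrite EFinM lee_wpmul2l ?lee_fin ?(ltW M_gt0)//.
  by apply: (integral_second_difference_le (ltW r_gt0) (ltW r_gt0) (ltW h0) FL); exact: diff0.
pose g x := ((h^-1)%:E * \sum_i (E x + D i x))%E.
have ED0 i x : (0 <= E x + D i x)%E by rewrite adde_ge0.
have mED i : measurable_fun setT (fun x => E x + D i x)%E by exact: emeasurable_funD.
have mS : measurable_fun setT (fun x => \sum_i (E x + D i x))%E by exact: emeasurable_sum.
have mg : measurable_fun setT g by exact: measurable_funeM.
apply: (@le_trans _ _ (\int[mu]_x g x)%E).
  apply: (le_integral_off_null mN N0 mg) => x xN.
  have [xr _ Ex] := EN x xN.
  have {}Ex i : ((h * `|(gradient phi x - T x) ord0 i|)%:E <= E x + D i x)%E.
    have [] := Ex i h h0.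
    have eh : enorm (h *: delta_mx 0 i : 'rV[R]_d) = h.
      by rewrite enormZ enorm_delta mulr1 gtr0_norm.
    have near_x (s : bool) : enorm (x + (-1) ^+ s *: (h *: delta_mx 0 i)) < r + 1.
      rewrite (le_lt_trans (ler_enormD _ _))// ltr_leD//.
      by rewrite enormZ normrX normrN1 expr1n mul1r eh.
    have := near_x false; rewrite expr0 scale1r => np /(_ np) E1.
    have := near_x true; rewrite expr1 scaleN1r => nm /(_ nm) E2.
    have -> : D i x = (second_difference F (h *: delta_mx 0 i) x)%:E.
      rewrite /D patchE mem_set//= => j.
      by rewrite (le_trans (ler_coord_enorm _ _))// ltW.
    have := FT x (x + h *: delta_mx 0 i); have := FT x (x - h *: delta_mx 0 i).
    rewrite ![x + _ - x]addrC !addKr dotvNr dotvZr dotv_delta !mxE.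
    rewrite /second_difference.
    case: (E x) (E0 x) E1 E2 => [e| |] // _; last by rewrite addye ?leey.
    rewrite -EFinD !lee_fin.
    move: (F (x + _)) (F (x - _)) (F x) (gradient phi x ord0 i) (T x ord0 i).
    move=> Fp Fm Fx v z E1 E2 S1 S2.
    rewrite -[h in h * `|_|]gtr0_norm// -normrM ler_norml mulrBr.
    exact: (abs_slope_le E1 E2 S1 S2).
  apply: (@le_trans _ _ (h^-1 * \sum_i h * `|(gradient phi x - T x) ord0 i|)%:E).
    rewrite lee_fin -mulr_sumr mulKf ?gt_eqF//; exact: ler_enorm_sum.
  rewrite EFinM /g lee_wpmul2l ?lee_fin ?invr_ge0 ?(ltW h0)//.
  by rewrite -sumEFin; apply: lee_sum => i _.
rewrite /g ge0_integralZl//; last 2 first.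
- by move=> x _; apply: sume_ge0.
- by rewrite lee_fin invr_ge0 ltW.
rewrite ge0_integral_sum//.
rewrite EFinM -muleA lee_wpmul2l ?lee_fin ?invr_ge0 ?(ltW h0)//.
apply: (@le_trans _ _ (\sum_(i < d) (gap + (M * (2 * r * (2 * r) ^+ d.-1 * h ^+ 2))%:E))%E).
  apply: lee_sum => i _; rewrite ge0_integralD//.
  exact: leeD.
by rewrite sumr_const card_ord mule_natl.
Qed.

End gradient_stability.

(** * Averages over a sample *)

Section sample_averages.
Context {R : realType} {d : nat}.
Context {dO : measure_display} {Omega : measurableType dO} (P : probability Omega R).
Context {n : nat} (X : 'I_n -> {RV P >-> 'rV[R]_d}) (mu : probability 'rV[R]_d R).
Hypotheses (n_gt0 : (0 < n)%N) (X_iid : iid_sample X mu).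
Local Open Scope ereal_scope.

Lemma sample_null (N : set 'rV[R]_d) : measurable N -> mu N = 0 ->
  exists B, [/\ measurable B, P B = 0 & forall w, ~ B w -> forall i, ~ N (X i w)].
Proof.
move=> mN N0; have mX i : measurable (X i @^-1` N) by exact: measurable_sample.
have mB : measurable (\big[setU/set0]_(i < n) (X i @^-1` N)) by exact: bigsetU_measurable.
exists (\big[setU/set0]_(i < n) (X i @^-1` N)); split => //.
  apply: measure_negligible => //; elim/big_ind : _ => [|A B nA nB|i _].
  - exact: negligible_set0.
  - exact: negligibleU.
  - by apply/negligibleP => //; have [_ same] := X_iid; rewrite -[LHS]/(P (X i @^-1` N)) same.
by move=> w wB i Ni; apply: wB; rewrite -bigcup_seq; exists i => //=; rewrite mem_index_enum.
Qed.

Lemma sample_integral_ge0 i (f : 'rV[R]_d -> \bar R) : measurable_fun setT f ->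
  (forall x, 0 <= f x) -> \int[P]_w f (X i w) = \int[mu]_x f x.
Proof.
move=> mf f0; have mX : measurable_fun setT (X i) by exact: measurable_funP.
rewrite -[LHS](ge0_integral_pushforward mX P measurableT mf); last by move=> x _.
by apply: eq_measure_integral => A mA _; have [_ same] := X_iid; exact: same.
Qed.

Lemma sample_integrable i (f : 'rV[R]_d -> \bar R) : mu.-integrable setT f ->
  P.-integrable setT (fun w => f (X i w)).
Proof.
move=> /integrableP[mf foo]; apply/integrableP; split.
  exact: measurableT_comp.
rewrite (@sample_integral_ge0 i (abse \o f))//; last by move=> x; exact: abse_ge0.
exact: measurableT_comp.
Qed.

Lemma sample_integral i (f : 'rV[R]_d -> \bar R) : mu.-integrable setT f ->
  \int[P]_w f (X i w) = \int[mu]_x f x.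
Proof.
move=> /[dup] fi /integrableP[mf foo]; rewrite integralE [RHS]integralE; congr (_ - _).
  rewrite -(sample_integral_ge0 i (measurable_funepos mf)) => [|x]; last exact: funepos_ge0.
  by apply: eq_integral => w _; rewrite !funeposE.
rewrite -(sample_integral_ge0 i (measurable_funeneg mf)) => [|x]; last exact: funeneg_ge0.
by apply: eq_integral => w _; rewrite !funenegE.
Qed.

Lemma sample_average_integrable (f : 'rV[R]_d -> \bar R) : mu.-integrable setT f ->
  P.-integrable setT (fun w => (n%:R^-1)%:E * \sum_i f (X i w)).
Proof.
move=> fi; apply: integrableZl => //; apply: integrable_sum => // i _.
exact: sample_integrable.
Qed.

Lemma sample_average_integral (f : 'rV[R]_d -> \bar R) : mu.-integrable setT f ->
  \int[P]_w ((n%:R^-1)%:E * \sum_i f (X i w)) = \int[mu]_x f x.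
Proof.
move=> fi; have Xi i := @sample_integrable i f fi.
rewrite integralZl//; last by apply: integrable_sum => // i _; exact: Xi.
rewrite integral_sum//.
rewrite (eq_bigr (fun=> \int[mu]_x f x)) => [|i _]; last exact: sample_integral.
have /fineK <- := integrable_fin_num measurableT fi.
rewrite sumEFin sumr_const card_ord -EFinM -[(fine _ *+ n)%R]mulr_natl mulrA mulVf ?mul1r//.
by rewrite pnatr_eq0 -lt0n.
Qed.

Lemma good_sample_points (r : R) (f : 'rV[R]_d -> \bar R) :
  mu (~` eball r) = 0 -> mu.-integrable setT f ->
  exists B, [/\ measurable B, P B = 0 &
    forall w, ~ B w -> forall i, (enorm (X i w) < r)%R /\ f (X i w) \is a fin_num].
Proof.
move=> mu_ball fi.
have [N [mN N0 sub]] := integrable_ae measurableT fi.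
have mC : measurable (~` eball r : set 'rV[R]_d) by apply: measurableC; exact: measurable_eball.
have mU : measurable (~` eball r `|` N) by exact: measurableU.
have U0 : mu (~` eball r `|` N) = 0.
  by apply: measure_negligible => //; apply: negligibleU; exact/negligibleP.
have [B [mB B0 good]] := sample_null mU U0.
exists B; split => // w wB i; have := good w wB i; rewrite /setU/= => /not_orP[].
rewrite not_notP => h1 h2; split => //; apply: contrapT => h; apply: h2; apply: sub => /=.
by move=> /(_ I).
Qed.

End sample_averages.

(** * Expected error of the estimator *)

Lemma expected_error_arith (R : realFieldType) (F chi a b r1 r2 c i1 i2 : R) :
  F + chi <= a + b ->
  F + r1 + (chi + r2) - (i1 + i2) + c <= a + b + (r1 + r2 + (c - (i1 + i2))).
Proof. by lra. Qed.

Section expected_error.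
Context {R : realType} {d : nat} (mu nu : probability 'rV[R]_d R) (r M : R).
Hypotheses (r_gt0 : (0 < r)%R) (M_gt0 : (0 < M)%R).
Hypotheses (mu_ball : mu (~` eball r) = 0%E) (nu_ball : nu (~` eball r) = 0%E).
Hypothesis muM : has_density_bounded_by mu M.
Context (phi : 'rV[R]_d -> \bar R) (phi_opt : optimal_brenier_potential mu nu phi).
Context (n m : nat) (n_gt0 : (0 < n)%N) (m_gt0 : (0 < m)%N).
Local Open Scope ereal_scope.

Context {dO : measure_display} {Omega : measurableType dO} (P : probability Omega R).
Context (X : 'I_n -> {RV P >-> 'rV[R]_d}) (Y : 'I_m -> {RV P >-> 'rV[R]_d}).
Hypotheses (X_iid : iid_sample X mu) (Y_iid : iid_sample Y nu).
Context (That : Omega -> 'rV[R]_d -> 'rV[R]_d).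
Hypothesis estim : forall w, monge_map_estimator (fun=> n%:R^-1%R) (fun i => X i w)
                                 (fun=> m%:R^-1%R) (fun j => Y j w) (That w).

Let K : R := (4 * d%:R * r + d%:R * r * 2 ^+ d)%R.

(** The gap is bounded by the empirical objective of phi and phi^* minus the
    optimal value, plus two deviations; the first two terms cancel in
    expectation because a sample average has the same mean as its law. This
    cancellation requires h not to depend on the sample. *)
Lemma expected_error_le (h s t : R) :
  (0 < h <= 1)%R ->
  (0 < s <= 1)%R -> (1 <= n%:R * s ^+ d.+2)%R ->
  (0 < t <= 1)%R -> (1 <= m%:R * t ^+ d.+2)%R ->
  \int[P]_w \int[mu]_x (enorm (gradient phi x - That w x))%:E <=
  (h^-1 * d%:R * (r * (K * s) + (r + 1) * (K * t) +
                  M * (2 * r * (2 * r) ^+ d.-1 * h ^+ 2)))%:E.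
Proof.
move=> h01 s01 ns t01 mt; have /andP[h0 _] := h01.
have rho0 : (0 < r + 1)%R by rewrite addr_gt0.
have [muphi nuphi] := potential_integrable r_gt0 mu_ball nu_ball muM phi_opt.
have [D1 [mD1 D10 ED1 HD1]] := empirical_lipschitz_deviation r_gt0 n_gt0 X_iid mu_ball s01 ns.
have [D2 [mD2 D20 ED2 HD2]] := empirical_lipschitz_deviation r_gt0 m_gt0 Y_iid nu_ball t01 mt.
have [B1 [mB1 B10 good1]] := good_sample_points X_iid mu_ball muphi.
have [B2 [mB2 B20 good2]] := good_sample_points Y_iid nu_ball nuphi.
have [i1 I1] : exists i1, \int[mu]_x phi x = i1%:E.
  by exists (fine (\int[mu]_x phi x)); rewrite fineK//; exact: integrable_fin_num.
have [i2 I2] : exists i2, \int[nu]_y conjugate phi y = i2%:E.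
  by exists (fine (\int[nu]_y conjugate phi y)); rewrite fineK//; exact: integrable_fin_num.
(* A and B are the empirical averages of phi and of its conjugate, whose means
   are i1 and i2 *)
pose c := (M * (2 * r * (2 * r) ^+ d.-1 * h ^+ 2))%R.
pose A w := (n%:R^-1)%:E * \sum_i phi (X i w).
pose B w := (m%:R^-1)%:E * \sum_j conjugate phi (Y j w).
pose Z w := (r * D1 w + (r + 1) * D2 w)%R.
pose G w := (h^-1 * d%:R)%:E * (A w + B w + ((Z w)%:E + (c - (i1 + i2))%:E)).
have iA : P.-integrable setT A := sample_average_integrable X_iid muphi.
have iB : P.-integrable setT B := sample_average_integrable Y_iid nuphi.
have mZ : measurable_fun setT Z.
  by apply: measurable_funD; exact: measurable_funM.
have EZ : \int[P]_w (Z w)%:E <= (r * (K * s) + (r + 1) * (K * t))%:E.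
  under eq_integral do rewrite EFinD !EFinM.
  rewrite ge0_integralD//; last 4 first.
  - by move=> w _; rewrite mule_ge0 ?lee_fin// ltW.
  - by apply: measurable_funeM; exact/measurable_EFinP.
  - by move=> w _; rewrite mule_ge0 ?lee_fin// ltW.
  - by apply: measurable_funeM; exact/measurable_EFinP.
  rewrite !ge0_integralZl//; try by [exact/measurable_EFinP|move=> w _; rewrite lee_fin|rewrite lee_fin ltW].
  rewrite (EFinD (r * _)%R) (EFinM r) (EFinM (r + 1)%R).
  by apply: leeD; rewrite lee_wpmul2l ?lee_fin// ltW.
have iZ : P.-integrable setT (EFin \o Z).
  apply/integrableP; split; first exact/measurable_EFinP.
  apply: le_lt_trans (ltry _); apply: le_trans EZ.
  rewrite le_eqVlt; apply/orP; left; apply/eqP; apply: eq_integral => w _ /=.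
  by rewrite ger0_norm// addr_ge0// mulr_ge0// ltW.
have icst : P.-integrable setT (fun=> (c - (i1 + i2))%:E).
  exact: finite_measure_integrable_cst.
have iAB : P.-integrable setT (fun w => A w + B w) by exact: integrableD.
have iZc : P.-integrable setT (fun w => (Z w)%:E + (c - (i1 + i2))%:E) by exact: integrableD.
have iG : P.-integrable setT G by apply: integrableZl => //; exact: integrableD.
have mB : measurable (B1 `|` B2) by exact: measurableU.
have B0 : P (B1 `|` B2) = 0.
  by apply: measure_negligible => //; apply: negligibleU; exact/negligibleP.
apply: (@le_trans _ _ (\int[P]_w G w)).
  apply: (le_integral_off_null mB B0 (measurable_int _ iG)) => w.
  rewrite /setU/= => /not_orP[/good1 gX /good2 gY].
  have [f [g [fg_opt subd]]] := estim w.
  have Yr j : (enorm (Y j w) < r)%R by have [] := gY j.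
  have Xr i : (enorm (X i w) < r)%R by have [] := gX i.
  have FL := real_dual_potential_lipschitz m_gt0 Yr g.
  have chiL := local_conjugate_lipschitz m_gt0 (ltW r_gt0) rho0 Yr g.
  have Fchi := fun b y => @local_conjugate_ge _ _ _ _ _ (r + 1)%R m_gt0 (ltW r_gt0) Yr g b y.
  have FT := subgradient_real m_gt0 subd.
  have phiX i : phi (X i w) = (fine (phi (X i w)))%:E by rewrite fineK//; have [] := gX i.
  have conjY j : conjugate phi (Y j w) = (fine (conjugate phi (Y j w)))%:E.
    by rewrite fineK//; have [] := gY j.
  have young i j : (dotv (X i w) (Y j w) <= fine (phi (X i w)) + fine (conjugate phi (Y j w)))%R.
    rewrite -lerBlDl -lee_fin -conjY; apply: conjugate_ge; by rewrite -phiX.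
  have emp := empirical_objective_le m_gt0 rho0 fg_opt young.
  have dev1 := HD1 w Xr _ r (ltW r_gt0) FL.
  have dev2 := HD2 w Yr _ (r + 1)%R (ltW rho0) chiL.
  apply: (le_trans (gradient_stability r_gt0 M_gt0 mu_ball nu_ball muM phi_opt FL (ltW rho0)
    chiL Fchi FT h01)).
  rewrite /G lee_wpmul2l//; first by rewrite lee_fin mulr_ge0// invr_ge0 ltW.
  rewrite /brenier_objective I1 I2 /A /B (eq_bigr _ (fun i _ => phiX i)).
  rewrite (eq_bigr _ (fun j _ => conjY j)) !sumEFin -!EFinM -!EFinD -EFinN.
  apply: (le_trans (leeD2r _ (leeD2r _ (leeD dev1 dev2)))).
  rewrite -!EFinD lee_fin -/c /Z; exact: expected_error_arith.
have EG : \int[P]_w G w = (h^-1 * d%:R)%:E * (i1%:E + i2%:E + (\int[P]_w (Z w)%:E + (c - (i1 + i2))%:E)).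
  rewrite integralZl//; last exact: integrableD.
  rewrite integralD// integralD// (@integralD _ _ _ P setT measurableT (EFin \o Z))//.
  rewrite integral_cst//= probability_setT mule1.
  by rewrite (sample_average_integral n_gt0 X_iid muphi) (sample_average_integral m_gt0 Y_iid nuphi) I1 I2.
rewrite EG; apply: (le_trans (lee_wpmul2l _ (leeD2l _ (leeD2r _ EZ)))).
  by rewrite lee_fin mulr_ge0// invr_ge0 ltW.
rewrite -!EFinD -EFinM lee_fin le_eqVlt; apply/orP; left; apply/eqP; rewrite /c; ring.
Qed.

End expected_error.

(** * Choice of the scales *)

Section scales.
Context {R : realType}.

(** The exponent q for which the claimed rate is the fourth root of
    n^(- 1 / q) + m^(- 1 / q), up to a logarithm when d = 2. *)
Definition rate_exponent (d : nat) : nat := if d == 1%N then 2%N else d.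

(** The exponent is chosen for the square of the scale to be n^(- 1 / q). *)
Definition sample_scale (d n : nat) : R := n%:R `^ (- (2 * (rate_exponent d)%:R)^-1).

Lemma rate_exponent_gt0 d : (0 < d)%N -> (0 < rate_exponent d)%N.
Proof. by rewrite /rate_exponent; case: ifP. Qed.

Lemma rate_exponent_ge d : (0 < d)%N -> (d.+2 <= 2 * rate_exponent d)%N.
Proof.
rewrite /rate_exponent; case: eqP => [->//|/eqP d1 d0].
by rewrite mul2n -addnn -addn2 leq_add2l ltn_neqAle eq_sym d1.
Qed.

Section fixed_sample.
Variables (d n : nat) (d_gt0 : (0 < d)%N) (n_gt0 : (0 < n)%N).

Let q0 : 0 < (rate_exponent d)%:R :> R.
Proof. by rewrite ltr0n rate_exponent_gt0. Qed.

Lemma sample_scale_gt0 : 0 < sample_scale d n.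
Proof. by rewrite powR_gt0// ltr0n. Qed.

Lemma sample_scale_expr k :
  sample_scale d n ^+ k = n%:R `^ (- (k%:R / (2 * (rate_exponent d)%:R))).
Proof. by rewrite -powR_mulrn ?powR_ge0// -powRrM mulNr mulrC. Qed.

Lemma sqr_sample_scale : sample_scale d n ^+ 2 = n%:R `^ (- (rate_exponent d)%:R^-1).
Proof. by rewrite sample_scale_expr; congr (_ `^ (- _)); field; rewrite gt_eqF. Qed.

Lemma sample_scale_inv : sample_scale d n ^+ (2 * rate_exponent d) = n%:R^-1.
Proof.
rewrite sample_scale_expr natrM divff ?gt_eqF ?mulr_gt0//.
by rewrite powR_inv1// ler0n.
Qed.

Lemma sample_scale_le1 : sample_scale d n <= 1.
Proof.
rewrite -(@expr_le1 _ (2 * rate_exponent d)) ?muln_gt0 ?rate_exponent_gt0//.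
  by rewrite sample_scale_inv invf_le1 ?ltr0n// ler1n.
exact: ltW sample_scale_gt0.
Qed.

(** Here d + 2 <= 2 q, and n^-1 is the power 2 q of the scale. *)
Lemma sample_scale_admissible : 1 <= n%:R * sample_scale d n ^+ d.+2.
Proof.
have n0 : 0 < n%:R :> R by rewrite ltr0n.
rewrite -ler_pdivrMl// mulr1 -sample_scale_inv.
apply: ler_wiXn2l; [exact: ltW sample_scale_gt0|exact: sample_scale_le1|].
exact: rate_exponent_ge.
Qed.

End fixed_sample.

(** The square root is the fourth root of the square, and (s + t)^2 is at most
    2 (s^2 + t^2). When d = 2 the logarithms are bounded below by ln 2, whence
    the term 2 / ln 2. *)
Lemma sqrt_scales_le_rate d n m : (0 < d)%N -> (0 < n)%N -> (0 < m)%N ->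
  Num.sqrt (sample_scale d n + sample_scale d m) <=
  (2 + 2 / ln 2) `^ 4^-1 * rate R d n m.
Proof.
move=> d0 n0 m0; have ln2 : 0 < ln (2 : R) by rewrite ln_gt0// ltr1n.
set s := sample_scale d n; set t := sample_scale d m.
have s0 : 0 <= s by exact: ltW (sample_scale_gt0 d n0).
have t0 : 0 <= t by exact: ltW (sample_scale_gt0 d m0).
have st : 0 <= s + t by rewrite addr_ge0.
have c0 : 0 <= 2 + 2 / ln 2 :> R by rewrite addr_ge0// divr_ge0// ltW.
pose S := s ^+ 2 + t ^+ 2.
have S0 : 0 <= S by rewrite addr_ge0 ?sqr_ge0.
have stS : (s + t) ^+ 2 <= 2 * S.
  by have := sqr_ge0 (s - t); rewrite /S; lra.
have lnS l : (0 < l)%N -> ln 2 <= ln (1 + l%:R) :> R.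
  by move=> l0; rewrite ler_ln ?posrE ?addr_gt0 ?ltr0n// nat1r ler_nat.
have [x [x0 rE Sx]] : exists x, [/\ 0 <= x, rate R d n m = x `^ 4^-1 &
    2 * S <= (2 + 2 / ln 2) * x].
  have S2 : 2 * S <= (2 + 2 / ln 2) * S.
    by rewrite ler_wpM2r// lerDl divr_ge0// ltW.
  have : S = n%:R `^ (- (rate_exponent d)%:R^-1) + m%:R `^ (- (rate_exponent d)%:R^-1).
    by rewrite /S /s /t !sqr_sample_scale.
  rewrite /rate /rate_exponent.
  have [_ SE|_] := eqVneq d 1%N; first by exists S; rewrite -?SE.
  have [-> SE|_ SE] := eqVneq d 2%N; last by exists S; rewrite -?SE.
  exists (n%:R `^ (- 2^-1) * ln (1 + n%:R) + m%:R `^ (- 2^-1) * ln (1 + m%:R)); split => //.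
  - by rewrite addr_ge0// mulr_ge0 ?powR_ge0// ln_ge0// lerDl.
  - apply: (@le_trans _ _ (2 / ln 2 * (ln 2 * S))).
      by rewrite mulrA divfK ?gt_eqF.
    apply: ler_pM; rewrite ?mulr_ge0 ?lerDr ?invr_ge0 ?(ltW ln2)//.
    by rewrite SE mulrDr lerD// mulrC ler_wpM2l ?powR_ge0// lnS.
have -> : Num.sqrt (s + t) = ((s + t) ^+ 2) `^ 4^-1.
  rewrite -powR12_sqrt// -powR_mulrn// -powRrM; by congr (_ `^ _); field.
rewrite rE -powRM//; apply: ge0_ler_powR; rewrite ?nnegrE ?mulr_ge0 ?sqr_ge0//.
exact: le_trans stS Sx.
Qed.

(** The choice h = x / 2 with x^2 = s + t balances the two terms; the factor 1 / 2
    keeps h below 1, because both scales are at most 1. *)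
Lemma half_sqrt_step (r K N e s t x : R) :
  0 <= e -> 0 <= K -> 0 <= s -> 0 < x -> x ^+ 2 = s + t ->
  (x / 2)^-1 * e * (r * (K * s) + (r + 1) * (K * t) + N * (x / 2) ^+ 2) <=
  e * (2 * (r + 1) * K + N / 2) * x.
Proof.
move=> e0 K0 s0 x0 xE; have x2 : 0 < x / 2 by rewrite divr_gt0.
have -> : e * (2 * (r + 1) * K + N / 2) * x =
    (x / 2)^-1 * e * ((r + 1) * (K * x ^+ 2) + N * (x / 2) ^+ 2).
  by field; rewrite gt_eqF.
rewrite ler_wpM2l ?mulr_ge0 ?invr_ge0 ?(ltW x2)// lerD2r xE.
by have := mulr_ge0 K0 s0; lra.
Qed.

End scales.

Theorem theorem3p7 (R : realType) (M r : R) (d : nat)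
    (M_gt0 : 0 < M) (r_gt0 : 0 < r) (d_gt0 : (0 < d)%N) :
  exists C : R, 0 < C /\
  forall (mu nu : probability 'rV[R]_d R),
    compactly_supported_in mu (eball r) ->
    compactly_supported_in nu (eball r) ->
    has_density_bounded_by mu M ->
  forall (n m : nat), (0 < n)%N -> (0 < m)%N ->
  forall (dO : measure_display) (Omega : measurableType dO)
    (P : probability Omega R)
    (X : 'I_n -> {RV P >-> 'rV[R]_d}) (Y : 'I_m -> {RV P >-> 'rV[R]_d}),
    iid_sample X mu -> iid_sample Y nu ->
  forall phi : 'rV[R]_d -> \bar R, optimal_brenier_potential mu nu phi ->
  forall That : Omega -> 'rV[R]_d -> 'rV[R]_d,
    (forall w, monge_map_estimator (fun=> n%:R^-1) (fun i => X i w)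
                                   (fun=> m%:R^-1) (fun j => Y j w) (That w)) ->
  (\int[P]_w \int[mu]_x (enorm (gradient phi x - That w x))%:E
     <= (C * rate R d n m)%:E)%E.
Proof.
pose K : R := 4 * d%:R * r + d%:R * r * 2 ^+ d.
pose N : R := M * (2 * r * (2 * r) ^+ d.-1).
have d0 : 0 < d%:R :> R by rewrite ltr0n.
have K0 : 0 < K by rewrite addr_gt0 ?mulr_gt0 ?exprn_gt0.
have N0 : 0 < N by rewrite !mulr_gt0 ?exprn_gt0 ?mulr_gt0.
pose c : R := d%:R * (2 * (r + 1) * K + N / 2).
have r1 : 0 < r + 1 by rewrite addr_gt0.
have c0 : 0 < c by rewrite mulr_gt0// addr_gt0// ?divr_gt0// !mulr_gt0.
have ln2 : 0 < ln (2 : R) by rewrite ln_gt0// ltr1n.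
exists (c * (2 + 2 / ln 2) `^ 4^-1); split.
  by rewrite mulr_gt0 ?powR_gt0 ?addr_gt0 ?divr_gt0.
move=> mu nu [_ /(msupport_full (measurable_eball _)) mu_ball].
move=> [_ /(msupport_full (measurable_eball _)) nu_ball] muM n m n0 m0 dO Omega P X Y.
move=> X_iid Y_iid phi phi_opt That estim.
have s0 := @sample_scale_gt0 R d n n0; have t0 := @sample_scale_gt0 R d m m0.
have s1 := @sample_scale_le1 R d n d_gt0 n0; have t1 := @sample_scale_le1 R d m d_gt0 m0.
set s := sample_scale d n in s0 s1; set t := sample_scale d m in t0 t1.
pose x := Num.sqrt (s + t).
have xE : x ^+ 2 = s + t by rewrite sqr_sqrtr// addr_ge0// ltW.
have x0 : 0 < x by rewrite sqrtr_gt0 addr_gt0.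
have x2 : x <= 2.
  by rewrite -ler_sqr ?nnegrE ?(ltW x0)// xE; move: s1 t1; lra.
have h01 : 0 < x / 2 <= 1 by rewrite divr_gt0//= ler_pdivrMr// mul1r.
have s01 : 0 < s <= 1 by rewrite s0.
have t01 : 0 < t <= 1 by rewrite t0.
have sn : 1 <= n%:R * s ^+ d.+2 := sample_scale_admissible d_gt0 n0.
have tm : 1 <= m%:R * t ^+ d.+2 := sample_scale_admissible d_gt0 m0.
have err := expected_error_le r_gt0 M_gt0 mu_ball nu_ball muM phi_opt n0 m0 X_iid Y_iid
  estim h01 s01 sn t01 tm.
apply: (le_trans err).
rewrite lee_fin -/K -/s -/t.
rewrite (_ : M * _ = N * (x / 2) ^+ 2); last by rewrite /N !mulrA.
apply: (le_trans (half_sqrt_step _ _ _ _ _ _ xE)); rewrite ?(ltW K0) ?(ltW s0) ?(ltW d0)//.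
rewrite -/c -mulrA; apply: ler_wpM2l; first exact: ltW.
exact: sqrt_scales_le_rate.
Qed.
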